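(* Let $B_k(z)=\sum_{j=0}^k b_{j,k}z^j$, $k=0,1,2,\ldots$, with $b_{j,k}\in\mathbb{C}$ and $b_{k,k}\ne0$ for all $k$, be a polynomial basis satisfying $$\limsup_{k\to\infty}\|B_k\|_\infty^{1/k}\le1\quad\text{and}\quad\lim_{k\to\infty}|b_{k,k}|^{1/k}=1.$$ For $P_n(z)=\sum_{k=0}^n A_kB_k(z)$, let $\{A_k\}_{k=0}^n$ be complex random variables satisfying $\mathbb{E}[|A_k|^t]<\infty$, $k=0,\ldots,n$, for a fixed $t>0$, and set $$D_n:=A_nb_{n,n}\sum_{k=0}^n A_kb_{0,k}.$$ Let $0<r<1$ and $0\le\alpha<\beta<2\pi$. If $\mathbb{E}[\log|D_n|]>-\infty$, then for all large $n\in\mathbb{N}$ we have $$\mathbb{E}\left[\left|\tau_n(A_r(\alpha,\beta))-\frac{\beta-\alpha}{2\pi}\right|\right]\le C_r\left[\frac1n\left(\frac1t\log\left(\sum_{k=0}^n\mathbb{E}[|A_k|^t]\right)+\log\max_{0\le k\le n}\|B_k\|_\infty-\frac12\mathbb{E}[\log|D_n|]\right)\right]^{1/2},\qquad( * )$$ where $$C_r=\sqrt{\frac{2\pi}{\mathbf{k}}}+\frac{2}{1-r},\qquad\mathbf{k}=\sum_{k=0}^{\infty}\frac{(-1)^k}{(2k+1)^2}\ \text{(Catalan's constant)}.$$ In particular, if $\mathbb{E}[\log|A_n|]>-\infty$ and $\mathbb{E}[\log|A_0+z|]\ge L>-\infty$ for all $z\in\mathbb{C}$, then $$\mathbb{E}[\log|D_n|]\ge\log|b_{0,0}b_{n,n}|+\mathbb{E}[\log|A_n|]+L>-\infty,$$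 and $( * )$ holds.
   Context: $\|B\|_\infty=\sup_{\mathbb{T}}|B|$, where $\mathbb{T}=\{z\in\mathbb{C}:|z|=1\}$. For a polynomial $P_n$ of degree $n$ with complex zeros $Z_1,\ldots,Z_n$ (listed with multiplicity), the zero counting measure is $\tau_n=\frac1n\sum_{k=1}^n\delta_{Z_k}$, a random unit Borel measure on $\mathbb{C}$. The annular sector is $A_r(\alpha,\beta)=\{z\in\mathbb{C}: r<|z|<1/r,\ \alpha\le\arg z<\beta\}$, where $0<r<1$ and $\arg z\in[0,2\pi)$.
   Formalization: The bound ( * ) is stated for 0 < t ≤ 1 only (for t > 1 the bracket can be negative for infinitely many n), and the ''in particular'' part assumes A_0 independent of (A_1,…,A_n) (otherwise D_n may vanish identically, e.g. A_n = −A_0, B_n = 1 + z^n). *)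

(* Defs.v *)
From HB Require Import structures.
From mathcomp Require Import all_boot all_order all_algebra.
From mathcomp Require Import complex.
From mathcomp Require Import all_classical all_reals all_analysis.

Set Implicit Arguments.
Unset Strict Implicit.
Unset Printing Implicit Defensive.

Import Order.TTheory GRing.Theory Num.Theory.
Import numFieldNormedType.Exports.

Local Open Scope classical_set_scope.
Local Open Scope complex_scope.
Local Open Scope ring_scope.

(* The real-valued modulus (`|z| on R[i] is itself complex-valued). *)
Notation cabs := ComplexField.Normc.normc.

Section Deterministic.
Variable R : realType.
Implicit Types (p : {poly R[i]}) (z : R[i]) (b : nat -> nat -> R[i]).

Definition sup_norm p : R :=
  sup [set cabs p.[z] | z in [set z : R[i] | cabs z = 1]].

(* b j k is the coefficient of 'X^j in B_k. *)
Definition basis_poly b (k : nat) : {poly R[i]} := \poly_(j < k.+1) b j k.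

(* The zeros of p listed with multiplicity: p is lead_coef p times the product
   of the 'X - z%:P for z in this list. The value at p = 0 is irrelevant. *)
Definition zeros p : seq R[i] := sval (closed_field_poly_normal p).

(* (1/n) \sum_k \d_(Z_k); here n is the nominal degree, which is the actual
   degree of the random polynomial outside the event A_n = 0. *)
Definition zero_counting_measure (n : nat) p (S : set R[i]) : R :=
  n%:R^-1 * \sum_(z <- zeros p) \1_S z.

Definition is_arg z (theta : R) : Prop :=
  [/\ 0 <= theta, theta < pi *+ 2 &
      z = (cabs z * cos theta) +i* (cabs z * sin theta)].

Definition annular_sector (r alpha beta : R) : set R[i] :=
  [set z | [/\ r < cabs z, cabs z < r^-1 &
     exists2 theta, is_arg z theta & alpha <= theta < beta]].

Definition catalan : R :=
  limn (series (fun k : nat => (-1) ^+ k / (k.*2.+1)%:R ^+ 2 : R)).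

Definition discrepancy_const (r : R) : R :=
  Num.sqrt (pi *+ 2 / catalan) + 2 / (1 - r).

End Deterministic.

Section Random.
Context {d : measure_display} {T : measurableType d} {R : realType}.
Implicit Types (P : probability T R) (b : nat -> nat -> R[i]).
Implicit Types (X : T -> R[i]) (A : nat -> T -> R[i]).

(* Borel sets of the complex plane are those of R * R through (Re, Im). *)
Definition complex_pair (z : R[i]) : measurableTypeR R * measurableTypeR R :=
  (complex.Re z, complex.Im z).

Definition complex_RV X : Prop := measurable_fun setT (complex_pair \o X).

(* E[log|X|] in the extended reals, with log 0 = -oo. The integral is -oo also
   when both the positive and the negative parts have infinite integral. *)
Definition expect_log P X : \bar R := (\int[P]_w lne (cabs (X w))%:E)%E.

Definition random_poly b A (n : nat) (w : T) : {poly R[i]} :=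
  \sum_(k < n.+1) A k w *: basis_poly b k.

Definition end_coefs b A (n : nat) (w : T) : R[i] :=
  A n w * b n n * \sum_(k < n.+1) A k w * b 0%N k.

(* A_0 is independent of (A_1, ..., A_n). It is enough to test on products of
   Borel sets, which form a pi-system generating the joint sigma-algebra. *)
Definition first_independent P A (n : nat) : Prop :=
  forall V : nat -> set (measurableTypeR R * measurableTypeR R),
    (forall k, measurable (V k)) ->
    let ev k := (complex_pair \o A k) @^-1` V k in
    P (ev 0%N `&` \bigcap_(k in [set k | (1 <= k <= n)%N]) ev k) =
    (P (ev 0%N) * P (\bigcap_(k in [set k | (1 <= k <= n)%N]) ev k))%E.

Definition expected_discrepancy P b A (n : nat) (r alpha beta : R) : \bar R :=
  ('E_P[fun w => (`|zero_counting_measure n (random_poly b A n w)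
                      (annular_sector r alpha beta)
                    - (beta - alpha) / (pi *+ 2)|)%R])%E.

Definition discrepancy_bound P b A (n : nat) (t r : R) : \bar R :=
  ((discrepancy_const r)%:E *
   sqrte ((n%:R^-1)%:E *
     ((t^-1)%:E * lne (\sum_(k < n.+1) 'E_P[fun w => (cabs (A k w) `^ t)%R])
      + (ln (\big[Num.max/0%R]_(k < n.+1) sup_norm (basis_poly b k)))%:E
      - (2^-1)%:E * expect_log P (end_coefs b A n))))%E.

End Random.

(* Main.v *)
Require Import Defs.
From HB Require Import structures.
From mathcomp Require Import all_boot all_order all_algebra.
From mathcomp Require Import complex.
From mathcomp Require Import all_classical all_reals all_analysis.
From mathcomp Require Import ring lra zify measurable_realfun.

Set Implicit Arguments.
Unset Strict Implicit.
Unset Printing Implicit Defensive.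

Import Order.TTheory GRing.Theory Num.Theory.
Import numFieldNormedType.Exports.

Local Open Scope classical_set_scope.
Local Open Scope complex_scope.
Local Open Scope ring_scope.

(** The deterministic heart is an inequality for one polynomial p of degree n with
    ends a_0, a_n and |p| <= B on the unit circle: with
    X = (1/n) log (B / sqrt |a_0 a_n|), the zeros satisfy
      |tau (A_r(alpha, beta)) - (beta - alpha) / (2 pi)| <= C_r sqrt X
    ([annular_discrepancy]). If X >= 1 this is trivial, so X <= sqrt X may be
    assumed, and the two terms of C_r come from two separate estimates.

    Arguments of the zeros. Moving each zero radially to the circle and making the
    polynomial monic gives Q with |Q| <= exp (n X) on the circle, because
    |zeta - z|^2 >= |z| |zeta - z / |z||^2 for |zeta| = 1 ([schur_bound]). In the
    disc, log |Q| is harmonic, at most n X, and vanishes at 0; Caratheodory's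
    coefficient inequality then bounds the k-th power sum of the zeros of Q by
    2 k n X ([power_sum_le]). An Erdos-Turan argument turns this into a bound on
    counts: an arc is tested against its indicator, widened by delta at both ends and
    convolved with a triangle of half-width delta. Widening costs delta / pi; the
    Fourier coefficients of the test function are the triangle multipliers divided by
    k, so the factor k of the power sums cancels and the error is at most 4 X / delta
    ([erdos_turan]). The choice delta = 2 sqrt (pi X) gives 4 / sqrt pi, which is
    below sqrt (2 pi / G) since pi^2 >= 8 and Catalan's constant G is at most 1
    ([four_div_sqrt_pi_le]). To stay with finite trigonometric sums, the indicator is
    replaced by its Fejer means, and integrals over the circle by averages over
    roots of unity.

    Moduli of the zeros. Reflecting the zeros of the disc in the circle shows that the
    Mahler measure of p is at most B ([mahler_measure_le]), hence that the sum of
    |log |z|| over the zeros is at most 2 n X. A zero off the annulus contributes at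
    least log (1/r) >= 1 - r, so at most 2 n X / (1 - r) zeros lie off it
    ([zeros_off_annulus]).

    Expectation. For p = P_n one has a_0 a_n = D_n and B = max |B_k| sum |A_k|, and
    t log (sum |A_k|) <= log (sum |A_k| ^ t) because t <= 1. Both the square root and
    the logarithm are concave, and replacing them by tangents at suitable points makes
    the bound linear in sum |A_k| ^ t and log |D_n| before it is integrated
    ([expected_discrepancy_le]); this is Jensen's inequality, reduced to the
    monotonicity and linearity of the integral, and it holds for every n >= 1.

    The special case. The constant coefficient is b_00 (A_0 + Z), where Z is a
    combination of A_1, ..., A_n and so independent of A_0. Conditioning on Z gives
    E log |A_0 + Z| >= L ([expect_log_add_ge]), and log |D_n| is a sum of three
    terms ([expect_log_end_coefs_ge]). *)

(** * Calculus and trigonometric preliminaries *)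

Section Calculus.
Variable R : realType.
Implicit Types (f g : R -> R) (x y a b c : R).

Lemma is_derive_addf f g x a b : is_derive x 1 f a -> is_derive x 1 g b ->
  is_derive x 1 (fun y => f y + g y) (a + b).
Proof. by move=> fa gb; exact: is_deriveD. Qed.

Lemma is_derive_oppf f x a : is_derive x 1 f a ->
  is_derive x 1 (fun y => - f y) (- a).
Proof. by move=> fa; exact: is_deriveN. Qed.

Lemma is_derive_scalef c f x a : is_derive x 1 f a ->
  is_derive x 1 (fun y => c * f y) (c * a).
Proof. by move=> fa; exact: is_deriveZ. Qed.

Lemma is_derive_sumf n (h : 'I_n -> R -> R) (dh : 'I_n -> R) x :
  (forall i, is_derive x 1 (h i) (dh i)) ->
  is_derive x 1 (fun y => \sum_(i < n) h i y) (\sum_(i < n) dh i).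
Proof.
move=> hd; have -> : (fun y => \sum_(i < n) h i y) = \sum_(i < n) h i.
  by apply/funext => y; rewrite fct_sumE.
exact: is_derive_sum.
Qed.

Lemma is_derive_affine c b x : is_derive x 1 (fun y => c * y + b) c.
Proof.
apply: (is_derive_eq (is_derive_addf (is_derive_scalef c (is_derive_id x 1))
  (is_derive_cst b x 1))).
by rewrite mulr1 addr0.
Qed.

Lemma is_derive_compf f g x a b : is_derive (g x) 1 f a -> is_derive x 1 g b ->
  is_derive x 1 (fun y => f (g y)) (a * b).
Proof. by move=> fa gb; exact: (@is_derive1_comp _ f g x a b fa gb). Qed.

Lemma is_derive_comp_affine f c b x a : is_derive (c * x + b) 1 f a ->
  is_derive x 1 (fun y => f (c * y + b)) (c * a).
Proof.
move=> fa; rewrite mulrC.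
exact: (is_derive_compf (g := fun y => c * y + b) fa (is_derive_affine c b x)).
Qed.

Lemma is_derive_expf n x : is_derive x 1 (fun y => y ^+ n) (n%:R * x ^+ n.-1).
Proof.
have := @is_deriveX R R id n x 1 1 (is_derive_id x 1).
by rewrite exprfctE [_%:A]mulr1.
Qed.

Lemma is_derive_sin_scale c x :
  is_derive x 1 (fun y => sin (c * y)) (c * cos (c * x)).
Proof.
have := @is_derive_comp_affine sin c 0 x _ (is_derive_sin _).
by under eq_fun do rewrite addr0; rewrite addr0.
Qed.

Lemma is_derive_cos_scale c x :
  is_derive x 1 (fun y => cos (c * y)) (c * - sin (c * x)).
Proof.
have := @is_derive_comp_affine cos c 0 x _ (is_derive_cos _).
by under eq_fun do rewrite addr0; rewrite addr0.
Qed.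

Lemma derive_ge0_le f (df : R -> R) a b : a <= b ->
  (forall x, a <= x <= b -> is_derive x 1 f (df x)) ->
  (forall x, a <= x <= b -> 0 <= df x) -> f a <= f b.
Proof.
move=> ab fd df0; rewrite -subr_ge0.
have [| |c cab ->] := @MVT_segment R f df a b ab.
- by move=> x; rewrite in_itv/= => /andP[ax xb]; apply: fd; rewrite !ltW.
- apply: derivable_within_continuous => x; rewrite in_itv/= => xab.
  by have [] := fd x xab.
- by rewrite mulr_ge0 ?subr_ge0// df0//; move: cab; rewrite in_itv.
Qed.

Lemma derive_le_increment f (df : R -> R) a b c : a <= b ->
  (forall x, a <= x <= b -> is_derive x 1 f (df x)) ->
  (forall x, a <= x <= b -> df x <= c) -> f b - f a <= c * (b - a).
Proof.
move=> ab fd dfc.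
suff : c * a + 0 + - f a <= c * b + 0 + - f b by rewrite mulrBr; lra.
apply: (@derive_ge0_le (fun x => c * x + 0 + - f x) (fun x => c + - df x)) => //.
  move=> x xab; apply: is_derive_addf; first exact: is_derive_affine.
  by apply: is_derive_oppf; exact: fd.
by move=> x xab; rewrite subr_ge0 dfc.
Qed.

Lemma derive_ge_increment f (df : R -> R) a b c : a <= b ->
  (forall x, a <= x <= b -> is_derive x 1 f (df x)) ->
  (forall x, a <= x <= b -> c <= df x) -> c * (b - a) <= f b - f a.
Proof.
move=> ab fd dfc; rewrite -lerN2 -mulNr opprB.
suff : - f b - - f a <= - c * (b - a) by lra.
apply: (@derive_le_increment (fun x => - f x) (fun x => - df x)) => //.
  by move=> x xab; apply: is_derive_oppf; exact: fd.
by move=> x xab; rewrite lerN2 dfc.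
Qed.

Definition second_difference f (delta y : R) : R :=
  f (y + delta) + f (y - delta) - 2 * f y.

(** Two applications of the mean value theorem: a lower bound for the second
    derivative passes to the second difference. *)
Lemma second_difference_ge f (f1 f2 : R -> R) c delta y : 0 <= delta ->
  (forall x, is_derive x 1 f (f1 x)) -> (forall x, is_derive x 1 f1 (f2 x)) ->
  (forall x, y - delta <= x <= y + delta -> c <= f2 x) ->
  c * delta ^+ 2 <= second_difference f delta y.
Proof.
move=> d0 fd f1d f2c; rewrite /second_difference.
pose h (u : R) := f (1 * u + y) + f (-1 * u + y) + - (c * u ^+ 2).
pose dh (u : R) :=
  1 * f1 (1 * u + y) + -1 * f1 (-1 * u + y) + - (c * (2%:R * u ^+ 1)).
have /= : h 0 <= h delta.
  apply: (@derive_ge0_le h dh) => // u.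
    move=> _; apply: is_derive_addf; first apply: is_derive_addf.
    - exact: is_derive_comp_affine.
    - exact: is_derive_comp_affine.
    - by apply/is_derive_oppf/is_derive_scalef; exact: is_derive_expf.
  move=> /andP[u0 ud].
  have : c * (2 * u) <= f1 (u + y) - f1 (- u + y).
    have -> : 2 * u = u + y - (- u + y) by ring.
    apply: (@derive_ge_increment f1 f2); first lra.
    by move=> x xu; apply: f2c; lra.
  by rewrite /dh !mul1r !mulN1r expr1; lra.
by rewrite /h !mul1r !mulN1r oppr0 !add0r expr0n/= mulr0 oppr0 !(addrC _ y); lra.
Qed.

End Calculus.

Section Trigonometry.
Variable R : realType.
Implicit Types (x y : R) (k n : nat).

Lemma cos_lt1 x : 0 < x < pi *+ 2 -> cos x < 1.
Proof.
move=> /andP[x0 x2].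
have s0 : 0 < sin (x / 2).
  by apply: sin_gt0_pi; rewrite divr_gt0//= ltr_pdivrMr// mulr_natr.
have -> : x = (x / 2) *+ 2 by rewrite -mulr_natr divfK.
rewrite cos_mulr2n cos2sin2 mulr2n; nra.
Qed.

Lemma cos_natmul_eq1 x n : cos x = 1 -> cos (n%:R * x) = 1.
Proof.
move=> c1; have s0 : sin x = 0 by apply: cos1sin0; rewrite c1 normr1.
elim: n => [|n IHn]; first by rewrite mul0r cos0.
by rewrite -natr1 mulrDl mul1r cosD IHn c1 s0 mulr0 subr0 mulr1.
Qed.

Lemma sin_natmul_pi n : sin (n%:R * pi) = 0 :> R.
Proof.
elim: n => [|n IHn]; first by rewrite mul0r sin0.
by rewrite -natr1 mulrDl mul1r sinD IHn sinpi mul0r mulr0 addr0.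
Qed.

Lemma cos_ge_parabola x : 0 <= x -> 1 - x ^+ 2 / 2 <= cos x.
Proof.
move=> x0.
have sinx y : 0 <= y -> sin y <= y.
  move=> y0; have := @derive_le_increment R sin cos 0 y 1 y0.
  rewrite sin0 !subr0 mul1r; apply=> z _.
  exact: cos_le1.
suff : cos 0 + 2^-1 * 0 ^+ 2 <= cos x + 2^-1 * x ^+ 2 :> R.
  by rewrite cos0 expr0n/= mulr0; lra.
apply: (@derive_ge0_le R (fun x => cos x + 2^-1 * x ^+ 2)
  (fun x => - sin x + 2^-1 * (2%:R * x ^+ 1))) => //.
  move=> y _; apply: is_derive_addf; apply: is_derive_scalef.
  exact: is_derive_expf.
by move=> y /andP[y0 _]; rewrite expr1 mulKf//; have := sinx y y0; lra.
Qed.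

(** Since cos (pi / 2) = 0, the parabola below the cosine gives pi^2 / 8 >= 1. *)
Lemma pi_sqr_ge8 : 8 <= (pi : R) ^+ 2.
Proof.
have := @cos_ge_parabola (pi / 2); rewrite cos_pihalf => h.
have := h _; rewrite divr_ge0 ?pi_ge0// => /(_ isT).
rewrite expr_div_n; lra.
Qed.

End Trigonometry.
(** * The Fejer kernel and a smoothed step *)

Section Fejer.
Variable R : realType.
Implicit Types (x y : R) (k K : nat).

Definition fejer_weight K k : R := 1 - k.+1%:R / K%:R.

Definition fejer K x : R :=
  2^-1 + \sum_(k < K) fejer_weight K k * cos (k.+1%:R * x).

(** The primitives of the kernel of orders one to three. As K grows, the first tends
    to the step function that jumps by pi at each multiple of 2 pi. *)
Definition fejer_step K x : R :=
  2^-1 * x + \sum_(k < K) fejer_weight K k * (k.+1%:R^-1 * sin (k.+1%:R * x)).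

Definition fejer_step2 K x : R :=
  4^-1 * x ^+ 2 +
  - \sum_(k < K) fejer_weight K k * (k.+1%:R ^- 2 * cos (k.+1%:R * x)).

Definition fejer_step3 K x : R :=
  12^-1 * x ^+ 3 +
  - \sum_(k < K) fejer_weight K k * (k.+1%:R ^- 3 * sin (k.+1%:R * x)).

Lemma is_derive_fejer_step K x : is_derive x 1 (fejer_step K) (fejer K x).
Proof.
apply: (@is_derive_eq _ _ _ _ _ _ _ (2^-1 * 1 +
  \sum_(k < K) fejer_weight K k *
    (k.+1%:R^-1 * (k.+1%:R * cos (k.+1%:R * x))))).
  apply: is_derive_addf.
  apply: is_derive_sumf => k; do 2 apply: is_derive_scalef.
  exact: is_derive_sin_scale.
by rewrite mulr1; congr (_ + _); apply: eq_bigr => k _; rewrite mulKf.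
Qed.

Lemma is_derive_fejer_step2 K x :
  is_derive x 1 (fejer_step2 K) (fejer_step K x).
Proof.
apply: (@is_derive_eq _ _ _ _ _ _ _ (4^-1 * (2%:R * x ^+ 1) +
  - \sum_(k < K) fejer_weight K k *
    (k.+1%:R ^- 2 * (k.+1%:R * - sin (k.+1%:R * x))))).
  apply: is_derive_addf.
    by apply: is_derive_scalef; exact: is_derive_expf.
  apply: is_derive_oppf; apply: is_derive_sumf => k.
  by do 2 apply: is_derive_scalef; exact: is_derive_cos_scale.
rewrite expr1 /fejer_step; congr (_ + _); first by field.
rewrite -sumrN; apply: eq_bigr => k _.
have k0 : k.+1%:R != 0 :> R by rewrite pnatr_eq0.
by field.
Qed.

Lemma is_derive_fejer_step3 K x :
  is_derive x 1 (fejer_step3 K) (fejer_step2 K x).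
Proof.
apply: (@is_derive_eq _ _ _ _ _ _ _ (12^-1 * (3%:R * x ^+ 2) +
  - \sum_(k < K) fejer_weight K k *
    (k.+1%:R ^- 3 * (k.+1%:R * cos (k.+1%:R * x))))).
  apply: is_derive_addf.
    by apply: is_derive_scalef; exact: is_derive_expf.
  apply: is_derive_oppf; apply: is_derive_sumf => k.
  by do 2 apply: is_derive_scalef; exact: is_derive_sin_scale.
rewrite /fejer_step2; congr (_ + - _); first by field.
apply: eq_bigr => k _.
have k0 : k.+1%:R != 0 :> R by rewrite pnatr_eq0.
by field.
Qed.

Lemma dirichlet_sum K x :
  2 * (1 - cos x) * (2^-1 + \sum_(k < K) cos (k.+1%:R * x)) =
  cos (K%:R * x) - cos (K.+1%:R * x).
Proof.
elim: K => [|K IHK]; first by rewrite big_ord0 mul0r cos0 mul1r; field.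
rewrite big_ord_recr/= addrA mulrDr IHK.
set u := K.+1%:R * x.
have -> : K.+2%:R * x = u + x by rewrite -natr1 mulrDl mul1r.
have -> : K%:R * x = u - x by rewrite /u -natr1 mulrDl mul1r addrK.
rewrite !cosD cosN sinN; ring.
Qed.

(** The kernel is the mean of the Dirichlet sums; the closed form shows that it is
    nonnegative and small away from the multiples of 2 pi. *)
Lemma fejer_closed_form K x : (0 < K)%N ->
  2 * (1 - cos x) * (K%:R * fejer K x) = 1 - cos (K%:R * x).
Proof.
move=> K0.
have -> : K%:R * fejer K x =
    K%:R / 2 + \sum_(k < K) (K%:R - k.+1%:R) * cos (k.+1%:R * x).
  rewrite /fejer mulrDr mulr_sumr; congr (_ + _); apply: eq_bigr => k _.
  by rewrite mulrA mulrBr mulr1 mulrCA divff ?mulr1// pnatr_eq0 -lt0n.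
elim: K {K0} => [|K IHK].
  by rewrite big_ord0 !mul0r cos0 subrr addr0 mulr0.
rewrite big_ord_recr/= subrr mul0r addr0.
under eq_bigr do rewrite -[K.+1%:R]natr1 addrAC mulrDl mul1r.
rewrite big_split/= -[K.+1%:R]natr1.
have -> : (K%:R + 1) / 2 + (\sum_(i < K) (K%:R - i.+1%:R) * cos (i.+1%:R * x) +
    \sum_(i < K) cos (i.+1%:R * x)) =
    K%:R / 2 + \sum_(i < K) (K%:R - i.+1%:R) * cos (i.+1%:R * x) +
    (2^-1 + \sum_(i < K) cos (i.+1%:R * x)) by field.
rewrite mulrDr IHK dirichlet_sum natr1; ring.
Qed.

Lemma fejer_weight_ge0 K k : (k < K)%N -> 0 <= fejer_weight K k.
Proof.
move=> kK; rewrite subr_ge0 ler_pdivrMr ?mul1r ?ler_nat// ltr0n.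
exact: leq_ltn_trans kK.
Qed.

Lemma fejer_ge0 K x : (0 < K)%N -> 0 <= fejer K x.
Proof.
move=> K0; have := cos_le1 x; rewrite le_eqVlt => /orP[/eqP c1|c1].
  rewrite addr_ge0// sumr_ge0// => k _.
  by rewrite cos_natmul_eq1// mulr1 fejer_weight_ge0.
have := fejer_closed_form x K0; have := cos_le1 (K%:R * x).
have K0' : 0 < K%:R :> R by rewrite ltr0n.
have : 0 < 2 * (1 - cos x) * K%:R by rewrite !mulr_gt0 ?subr_gt0.
rewrite mulrA => p0 le1 e; rewrite -(pmulr_rge0 _ p0) e subr_ge0 //.
Qed.

Lemma fejer_le K x : (0 < K)%N -> cos x < 1 ->
  fejer K x <= (K%:R * (1 - cos x))^-1.
Proof.
move=> K0 c1; have := fejer_closed_form x K0; have := cos_geN1 (K%:R * x).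
have K0' : 0 < K%:R :> R by rewrite ltr0n.
have p0 : 0 < K%:R * (1 - cos x) by rewrite !mulr_gt0 ?subr_gt0.
move=> ge1 e; rewrite -[leRHS]mulr1 ler_pdivlMl//; nra.
Qed.

Lemma fejer_step_pi K : fejer_step K pi = pi / 2.
Proof.
rewrite /fejer_step big1; first by rewrite addr0 [LHS]mulrC.
by move=> k _; rewrite sin_natmul_pi !mulr0.
Qed.

Lemma fejer_step_nondecreasing K x y : (0 < K)%N -> x <= y ->
  fejer_step K x <= fejer_step K y.
Proof.
move=> K0 xy; apply: (@derive_ge0_le R _ (fejer K)) => // z _.
  exact: is_derive_fejer_step.
exact: fejer_ge0.
Qed.

(** Off the origin the kernel is O(1/K), so the step climbs to its mean height
    pi / 2 arbitrarily close to the jump. *)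
Lemma fejer_step_ge K eta : (0 < K)%N -> 0 < eta <= pi ->
  pi / 2 - pi / (K%:R * (1 - cos eta)) <= fejer_step K eta.
Proof.
move=> K0 /andP[eta0 etapi].
have pi0 := pi_gt0 R.
have c1 : cos eta < 1 by apply: cos_lt1; rewrite eta0/= mulr2n; lra.
have K0' : 0 < K%:R :> R by rewrite ltr0n.
have p0 : 0 < K%:R * (1 - cos eta) by rewrite !mulr_gt0 ?subr_gt0.
have := @derive_le_increment R (fejer_step K) (fejer K) eta pi
  ((K%:R * (1 - cos eta))^-1) etapi.
rewrite fejer_step_pi => /(_ (fun x _ => is_derive_fejer_step K x)) h.
have /h : forall x, eta <= x <= pi -> fejer K x <= (K%:R * (1 - cos eta))^-1.
  move=> x /andP[ex xpi].
  have cx : cos x <= cos eta.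
    have [->//|ne] := eqVneq x eta.
    apply/ltW; rewrite ltr_cos ?in_itv/=; [|lra|lra].
    by rewrite lt_neqAle eq_sym ne.
  apply: (le_trans (fejer_le K0 _)); first lra.
  by rewrite lef_pV2 ?posrE ?mulr_gt0 ?subr_gt0 ?ler_pM2l//; lra.
have i0 : 0 < (K%:R * (1 - cos eta))^-1 by rewrite invr_gt0.
nra.
Qed.

Lemma fejer_step_le K x : (0 < K)%N -> x <= pi -> fejer_step K x <= pi / 2.
Proof. by move=> K0 xpi; rewrite -(fejer_step_pi K) fejer_step_nondecreasing. Qed.

(** The Fourier multiplier, at frequency k + 1, of the convolution with the triangle
    of half-width delta and unit mass. *)
Definition triangle_coef (delta : R) k : R :=
  2 * (1 - cos (k.+1%:R * delta)) / (k.+1%:R ^+ 2 * delta ^+ 2).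

Lemma triangle_coef_ge0 delta k : 0 <= triangle_coef delta k.
Proof. apply: divr_ge0; first by rewrite mulr_ge0// subr_ge0 cos_le1.
by rewrite -exprMn sqr_ge0. Qed.

(** The convolution of [fejer_step] with that triangle. *)
Definition smooth_step K (delta x : R) : R :=
  2^-1 * x + \sum_(k < K) fejer_weight K k * triangle_coef delta k *
                          (k.+1%:R^-1 * sin (k.+1%:R * x)).

(** Convolution with the triangle is the second difference of a second primitive. *)
Lemma smooth_stepE K delta x : delta != 0 ->
  smooth_step K delta x = delta ^- 2 * second_difference (fejer_step3 K) delta x.
Proof.
move=> d0; rewrite /second_difference /fejer_step3.
set f := fun y => \sum_(k < K) fejer_weight K k * (k.+1%:R ^- 3 * sin (k.+1%:R * y)).
rewrite -/(f (x + delta)) -/(f (x - delta)) -/(f x).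
have fE : f (x + delta) + f (x - delta) - 2 * f x = - delta ^+ 2 *
    \sum_(k < K) fejer_weight K k * triangle_coef delta k *
                          (k.+1%:R^-1 * sin (k.+1%:R * x)).
  rewrite /f 2!mulr_sumr -big_split -sumrB/=; apply: eq_bigr => k _.
  have k0 : k.+1%:R != 0 :> R by rewrite pnatr_eq0.
  rewrite /triangle_coef mulrDr mulrBr !sinD cosN sinN.
  move: (k.+1%:R) k0 => m m0.
  by field; rewrite d0 m0.
have -> : 12^-1 * (x + delta) ^+ 3 + - f (x + delta) +
    (12^-1 * (x - delta) ^+ 3 + - f (x - delta)) -
    2 * (12^-1 * x ^+ 3 + - f x) =
    2^-1 * x * delta ^+ 2 - (f (x + delta) + f (x - delta) - 2 * f x) by field.
by rewrite fE /smooth_step; field.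
Qed.

Lemma smooth_stepN K delta x : smooth_step K delta (- x) = - smooth_step K delta x.
Proof.
rewrite /smooth_step opprD mulrN -sumrN; congr (_ + _); apply: eq_bigr => k _.
by rewrite mulrN sinN !mulrN.
Qed.

Lemma smooth_step_nondecreasing K delta x y : (0 < K)%N -> 0 < delta -> x <= y ->
  smooth_step K delta x <= smooth_step K delta y.
Proof.
move=> K0 d0 xy; rewrite !smooth_stepE ?gt_eqF// ler_pM2l ?invr_gt0 ?exprn_gt0//.
pose f2 u := second_difference (fejer_step2 K) delta u.
apply: (@derive_ge0_le R (second_difference (fejer_step3 K) delta) f2 x y xy) => z _.
  have d3 c : is_derive z 1 (fun u => fejer_step3 K (u + c)) (fejer_step2 K (z + c)).
    have := @is_derive_comp_affine R (fejer_step3 K) 1 c z (fejer_step2 K (z + c)).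
    rewrite !mul1r => /(_ (is_derive_fejer_step3 K _)).
    by under [X in is_derive _ _ X _]eq_fun do rewrite mul1r.
  apply: is_derive_addf.
  by apply/is_derive_oppf/is_derive_scalef; exact: is_derive_fejer_step3.
have := @second_difference_ge R (fejer_step2 K) (fejer_step K) (fejer K) 0 delta z
  (ltW d0) (is_derive_fejer_step2 K) (is_derive_fejer_step K).
by rewrite mul0r; apply=> u _; exact: fejer_ge0.
Qed.

Lemma smooth_step_ge K delta eta : (0 < K)%N -> 0 < delta -> 0 < eta <= pi ->
  pi / 2 - pi / (K%:R * (1 - cos eta)) <= smooth_step K delta (delta + eta).
Proof.
move=> K0 d0 eta0.
rewrite smooth_stepE ?gt_eqF// ler_pdivlMl ?exprn_gt0// mulrC.
apply: (@second_difference_ge R _ (fejer_step2 K) (fejer_step K) _ _ _ (ltW d0)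
  (is_derive_fejer_step3 K) (is_derive_fejer_step2 K)) => x /andP[xe _].
apply: (le_trans (fejer_step_ge K0 eta0)).
by apply: fejer_step_nondecreasing => //; lra.
Qed.

(** Up to an additive constant, the sum is a second difference of [fejer_step2] at 0,
    and the derivative of that function stays below pi / 2 on [0, pi]. The bound is pi
    times the height of the triangle. *)
Lemma sum_triangle_coef_le K delta : (0 < K)%N -> 0 < delta <= pi ->
  \sum_(k < K) fejer_weight K k * triangle_coef delta k <= pi / delta.
Proof.
move=> K0 /andP[d0 dpi].
have := @derive_le_increment R (fejer_step2 K) (fejer_step K) 0 delta (pi / 2)
  (ltW d0) (fun x _ => is_derive_fejer_step2 K x).
have ub x : 0 <= x <= delta -> fejer_step K x <= pi / 2.
  by move=> /andP[_ xd]; apply: fejer_step_le => //; exact: le_trans dpi.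
move=> /(_ ub).
suff -> : fejer_step2 K delta - fejer_step2 K 0 = 4^-1 * delta ^+ 2 +
    delta ^+ 2 / 2 * \sum_(k < K) fejer_weight K k * triangle_coef delta k.
  rewrite subr0 ler_pdivlMr// => h.
  rewrite -(ler_pM2l (divr_gt0 d0 (ltr0n _ 2))).
  have : 0 <= delta ^+ 2 by rewrite sqr_ge0.
  by move: h; set S := \sum_(_ < _) _; lra.
rewrite /fejer_step2 expr0n/= mulr0 add0r opprK -addrA; congr (_ + _).
rewrite addrC -sumrB mulr_sumr; apply: eq_bigr => k _.
have k0 : k.+1%:R != 0 :> R by rewrite pnatr_eq0.
rewrite mulr0 cos0 /triangle_coef; move: (k.+1%:R) k0 => m m0.
by field; rewrite m0 gt_eqF.
Qed.

End Fejer.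
(** * An Erdos-Turan inequality *)

Section ErdosTuran.
Variable R : realType.
Implicit Types (th : seq R) (H delta eta a b : R).

Lemma sum_const_seq (I : Type) (s : seq I) (c : R) :
  \sum_(x <- s) c = (size s)%:R * c.
Proof. by rewrite big_const_seq count_predT iter_addr_0 mulr_natl. Qed.

Lemma sum_sin_le th H k c : (0 < k)%N ->
  (forall c, \sum_(x <- th) cos (k%:R * (x - c)) <= 2 * k%:R * H) ->
  \sum_(x <- th) sin (k%:R * (x - c)) <= 2 * k%:R * H /\
  - \sum_(x <- th) sin (k%:R * (x - c)) <= 2 * k%:R * H.
Proof.
move=> k0 hc; have k0' : k%:R != 0 :> R by rewrite pnatr_eq0 -lt0n.
split.
  apply: le_trans (hc (c + pi / (2 * k%:R))).
  apply: ler_sum => x _; rewrite -cosBpihalf.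
  move: (pi) => p.
  suff -> : k%:R * (x - c) - p / 2 = k%:R * (x - (c + p / (2 * k%:R))) by [].
  by field.
apply: le_trans (hc (c - pi / (2 * k%:R))).
rewrite -sumrN; apply: ler_sum => x _; rewrite -cosDpihalf.
move: (pi) => p.
suff -> : k%:R * (x - c) + p / 2 = k%:R * (x - (c - p / (2 * k%:R))) by [].
by field.
Qed.

(** Test the points against the difference of two translates of the smoothed
    step: it is nonnegative, almost 1 on [a, b], its mean exceeds that of the
    indicator of [a, b] by (delta + eta) / pi, and its k-th Fourier coefficient is
    at most the k-th triangle multiplier over (pi k), which the power sum bound
    2 k H turns into a summable quantity. *)
Lemma erdos_turan_smoothed th H delta eta a b K : 0 <= H ->
  (forall k c, (0 < k)%N ->
     \sum_(x <- th) cos (k%:R * (x - c)) <= 2 * k%:R * H) ->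
  0 < delta <= pi -> 0 < eta <= pi -> a <= b -> (0 < K)%N ->
  (\sum_(x <- th) (a <= x <= b)%R%:R) * (1 - 2 / (K%:R * (1 - cos eta))) <=
  (size th)%:R * (b - a + 2 * (delta + eta)) / (2 * pi) + 4 * H / delta.
Proof.
move=> H0 hH delta0 eta0 ab K0.
have pi0 := pi_gt0 R.
have d0 : 0 < delta by case/andP: delta0.
have e0 : 0 < eta by case/andP: eta0.
set eps := (K%:R * (1 - cos eta))^-1.
pose S := smooth_step K delta.
have [a' a'E] : exists a', a' = a - (delta + eta) by eexists.
have [b' b'E] : exists b', b' = b + (delta + eta) by eexists.
have Smono x y : x <= y -> S x <= S y by exact: smooth_step_nondecreasing.
have Sbig y : delta + eta <= y -> pi / 2 - pi * eps <= S y.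
  by move=> hy; apply: le_trans (Smono _ _ hy); exact: smooth_step_ge.
have F_ge x : (a <= x <= b)%R%:R * (pi - 2 * pi * eps) <= S (x - a') - S (x - b').
  have [/andP[ax xb]|_] := boolP (a <= x <= b); last first.
    by rewrite mul0r subr_ge0 Smono//; lra.
  have h1 : pi / 2 - pi * eps <= S (x - a') by apply: Sbig; lra.
  have : pi / 2 - pi * eps <= S (b' - x) by apply: Sbig; lra.
  by rewrite -[b' - x]opprB /S smooth_stepN mul1r -/S; lra.
pose wm (k : nat) : R := fejer_weight R K k * triangle_coef delta k.
have F_sum : \sum_(x <- th) (S (x - a') - S (x - b')) <=
    (size th)%:R * ((b' - a') / 2) + 4 * H * \sum_(k < K) wm k.
  have -> : \sum_(x <- th) (S (x - a') - S (x - b')) =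
      \sum_(x <- th) (b' - a') / 2 + \sum_(k < K) wm k *
         (k.+1%:R^-1 * (\sum_(x <- th) sin (k.+1%:R * (x - a')) -
                        \sum_(x <- th) sin (k.+1%:R * (x - b')))).
    under [X in _ = _ + X]eq_bigr do rewrite -sumrB 2!mulr_sumr.
    rewrite exchange_big -big_split/=; apply: eq_bigr => x _.
    under [in RHS]eq_bigr do rewrite 2!mulrBr.
    by rewrite sumrB /S /smooth_step; lra.
  rewrite sum_const_seq lerD2l mulr_sumr; apply: ler_sum => k _.
  rewrite mulrC ler_wpM2r//.
    by rewrite mulr_ge0 ?fejer_weight_ge0 ?triangle_coef_ge0.
  have k0 : 0 < k.+1%:R :> R by rewrite ltr0n.
  rewrite ler_pdivrMl//.
  have [+ _] := @sum_sin_le th H k.+1 a' isT (fun c => hH k.+1 c isT).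
  have [_ +] := @sum_sin_le th H k.+1 b' isT (fun c => hH k.+1 c isT).
  by lra.
have wm_le : \sum_(k < K) wm k <= pi / delta by exact: sum_triangle_coef_le.
have count_le : (\sum_(x <- th) (a <= x <= b)%R%:R) * (pi - 2 * pi * eps) <=
    (size th)%:R * ((b' - a') / 2) + 4 * H * (pi / delta).
  rewrite mulr_suml; apply: (le_trans (ler_sum _ (fun x _ => F_ge x))).
  apply: (le_trans F_sum); rewrite lerD2l ler_wpM2l//.
  by rewrite mulr_ge0.
rewrite -(ler_pM2r pi0).
have -> : ((size th)%:R * (b - a + 2 * (delta + eta)) / (2 * pi) + 4 * H / delta)
    * pi = (size th)%:R * ((b' - a') / 2) + 4 * H * (pi / delta).
  by rewrite a'E b'E; move: (pi) pi0 => p p0; field; rewrite !lt0r_neq0.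
by apply: le_trans count_le; rewrite le_eqVlt; apply/orP; left; apply/eqP; ring.
Qed.

(** The limit of [erdos_turan_smoothed] as K tends to infinity and then eta to 0. *)
Lemma erdos_turan th H delta a b : 0 <= H ->
  (forall k c, (0 < k)%N ->
     \sum_(x <- th) cos (k%:R * (x - c)) <= 2 * k%:R * H) ->
  0 < delta <= pi -> a <= b ->
  \sum_(x <- th) (a <= x <= b)%R%:R <=
  (size th)%:R * (b - a) / (2 * pi) + (size th)%:R * delta / pi + 4 * H / delta.
Proof.
move=> H0 hH delta0 ab; apply/ler_addgt0Pr => e e0.
have pi0 := pi_gt0 R.
set N : R := (size th)%:R; set C := \sum_(x <- th) _.
have N0 : 0 <= N by rewrite ler0n.
have CN : C <= N.
  rewrite -[N]mulr1 -sum_const_seq; apply: ler_sum => x _.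
  by rewrite -[1]/(1%:R) ler_nat leq_b1.
have C0 : 0 <= C by apply: sumr_ge0 => x _; rewrite ler0n.
(* eta, and then K, make each of the two errors at most e / 2. *)
pose eta := Num.min pi (pi * e / (2 * (N + 1))).
have N1 : 0 < 2 * (N + 1) by lra.
have eta0 : 0 < eta <= pi.
  by rewrite lt_min pi0 ge_min lexx/= divr_gt0// mulr_gt0.
have Neta : N * eta / pi <= e / 2.
  have : eta <= pi * e / (2 * (N + 1)) by rewrite ge_min lexx orbT.
  rewrite ler_pdivlMr// ler_pdivrMr// => h.
  by case/andP: eta0 => etap _; clearbody eta; lra.
have c1 : 0 < 1 - cos eta.
  by rewrite subr_gt0 cos_lt1//; case/andP: eta0 => -> ?; rewrite mulr2n; lra.
pose K := (Num.truncn (4 * N / (e * (1 - cos eta)))).+1.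
have K0 : 0 < K%:R :> R by rewrite ltr0n.
have hK : N * (2 / (K%:R * (1 - cos eta))) <= e / 2.
  have : 4 * N / (e * (1 - cos eta)) < K%:R by exact: truncnS_gt.
  move: (K%:R : R) K0 => k k0.
  by rewrite ltr_pdivrMr ?mulr_gt0// => h; rewrite mulrA ler_pdivrMr ?mulr_gt0//; lra.
have := @erdos_turan_smoothed th H delta eta a b K H0 hH delta0 eta0 ab isT.
rewrite -/N -/C => h.
have : C * (2 / (K%:R * (1 - cos eta))) <= e / 2.
  by apply: le_trans hK; apply: ler_wpM2r => //.
have -> : N * (b - a) / (2 * pi) + N * delta / pi = 
  N * (b - a + 2 * (delta + eta)) / (2 * pi) - N * eta / pi.
  by move: (pi) pi0 => p p0; field; rewrite lt0r_neq0.
by move: h Neta; lra.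
Qed.

End ErdosTuran.
(** * Polynomials on the unit circle *)

Section UnitCircle.
Variable R : realType.
Implicit Types (x y rho B : R) (z : R[i]) (p : {poly R[i]}).

Definition cis x : R[i] := cos x +i* sin x.

Lemma cis0 : cis 0 = 1.
Proof. by rewrite /cis cos0 sin0. Qed.

Lemma cisD x y : cis (x + y) = cis x * cis y.
Proof. by rewrite /cis cosD sinD; simpc; congr (_ +i* _); rewrite addrC. Qed.

Lemma cisX x n : cis x ^+ n = cis (n%:R * x).
Proof.
elim: n => [|n IHn]; first by rewrite mul0r cis0.
by rewrite exprSr IHn -cisD -natr1 mulrDl mul1r.
Qed.

Lemma cabs_ge0 z : 0 <= cabs z.
Proof. by case: z => a b; exact: sqrtr_ge0. Qed.

Lemma cabs_sqr z : cabs z ^+ 2 = complex.Re z ^+ 2 + complex.Im z ^+ 2.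
Proof. by case: z => a b; rewrite /= sqr_sqrtr ?addr_ge0 ?sqr_ge0. Qed.

Lemma cabs_cis x : cabs (cis x) = 1.
Proof. by rewrite /cis /= cos2Dsin2 sqrtr1. Qed.

Lemma cabs_real x : 0 <= x -> cabs x%:C = x.
Proof. by move=> x0; rewrite /= expr0n/= addr0 sqrtr_sqr ger0_norm. Qed.

Lemma cabs_natr n : cabs n%:R = n%:R :> R.
Proof. by rewrite -(rmorph_nat (real_complex R)) cabs_real. Qed.

Lemma cabs0 : cabs (0 : R[i]) = 0.
Proof. exact: ComplexField.Normc.normc0. Qed.

Lemma cabs1 : cabs (1 : R[i]) = 1.
Proof. exact: ComplexField.Normc.normc1. Qed.

Lemma cabsN z : cabs (- z) = cabs z.
Proof. exact: normcN. Qed.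

Lemma cabs_eq0 z : (cabs z == 0) = (z == 0).
Proof.
apply/eqP/eqP => [/ComplexField.Normc.eq0_normc//|->].
exact: cabs0.
Qed.

Lemma cabs_gt0 z : (0 < cabs z) = (z != 0).
Proof. by rewrite lt_neqAle cabs_ge0 andbT eq_sym cabs_eq0. Qed.

Lemma cabsM z1 z2 : cabs (z1 * z2) = cabs z1 * cabs z2.
Proof. exact: ComplexField.Normc.normcM. Qed.

Lemma cabsX z n : cabs (z ^+ n) = cabs z ^+ n.
Proof.
elim: n => [|n IHn]; first exact: cabs1.
by rewrite !exprS cabsM IHn.
Qed.

Lemma cabs_prod (I : Type) (s : seq I) (F : I -> R[i]) :
  cabs (\prod_(i <- s) F i) = \prod_(i <- s) cabs (F i).
Proof.
elim: s => [|i s IHs]; first by rewrite !big_nil cabs1.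
by rewrite !big_cons cabsM IHs.
Qed.

Lemma cabs_sum_le (I : Type) (s : seq I) (F : I -> R[i]) :
  cabs (\sum_(i <- s) F i) <= \sum_(i <- s) cabs (F i).
Proof.
elim: s => [|i s IHs]; first by rewrite !big_nil cabs0.
by rewrite !big_cons; apply: le_trans (le_normcD _ _) _; rewrite lerD2l.
Qed.

Definition unit_root (M : nat) : R[i] := cis (pi *+ 2 / M%:R).

Lemma unit_root_primitive M : (0 < M)%N -> M.-primitive_root (unit_root M).
Proof.
move=> M0; have M0' : 0 < M%:R :> R by rewrite ltr0n.
rewrite /primitive_root_of_unity M0/=; apply/forallP => -[i iM] /=.
apply/eqP; rewrite unity_rootE /unit_root cisX.
have [->|neM] := eqVneq i.+1 M.
  have -> : M%:R * (pi *+ 2 / M%:R) = pi *+ 2 :> R.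
    by rewrite mulrCA divff ?mulr1 ?gt_eqF.
  by rewrite /cis cos2pi sin2pi eqxx.
apply/negbTE/eqP => -[c1 _].
have := @cos_lt1 R (i.+1%:R * (pi *+ 2 / M%:R)).
have pi2 : 0 < (pi : R) *+ 2 by rewrite mulrn_wgt0// pi_gt0.
rewrite c1 ltxx => /(_ _); apply/not_implyP; split => //.
rewrite mulr_gt0 ?divr_gt0//= mulrA ltr_pdivrMr// mulrC ltr_pM2l// ltr_nat.
by rewrite ltn_neqAle neM.
Qed.

Lemma sum_prim_root_powers (M m : nat) z : M.-primitive_root z ->
  \sum_(i < M) (z ^+ m) ^+ i = if (M %| m)%N then M%:R else 0.
Proof.
move=> zM; rewrite (prim_order_dvd zM); case: ifPn => [/eqP ->|zm1].
  by rewrite (eq_bigr (fun=> 1)) ?sumr_const ?card_ord// => i _; rewrite expr1n.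
apply: (mulfI (_ : z ^+ m - 1 != 0)); first by rewrite subr_eq0.
by rewrite -subrX1 mulr0 exprAC (prim_expr_order zM) expr1n subrr.
Qed.

(** Averaging over roots of unity isolates a coefficient. *)
Lemma coef_le_circle p B : (forall x, cabs p.[cis x] <= B) ->
  forall j, cabs p`_j <= B.
Proof.
move=> pB j; have B0 : 0 <= B by apply: le_trans (pB 0); exact: cabs_ge0.
have [sj|js] := leqP (size p) j.
  by rewrite nth_default// cabs0.
set M := size p in js *.
have M0 : (0 < M)%N by exact: leq_ltn_trans js.
have prim := unit_root_primitive M0; set w := unit_root M in prim *.
have e : \sum_(i < M) w ^+ (i * (M - j)) * p.[w ^+ i] = M%:R * p`_j.
  under eq_bigr do rewrite horner_coef mulr_sumr.
  rewrite exchange_big /= (bigD1 (Ordinal js))//= [X in _ + X]big1 => [|l lj].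
    rewrite addr0.
    under eq_bigr do rewrite mulrCA -exprM -exprD -mulnDr subnK 1?ltnW// mulnC exprM.
    rewrite -mulr_sumr.
    by have := sum_prim_root_powers M prim; rewrite dvdnn => ->; rewrite mulrC.
  under eq_bigr do rewrite mulrCA -exprM -exprD -mulnDr mulnC exprM.
  rewrite -mulr_sumr sum_prim_root_powers// ifF ?mulr0//.
  apply/negbTE/negP => dv; move/eqP: lj; apply; apply/val_inj => /=.
  have := ltn_ord l; rewrite -/M => lM.
  have /dvdnP[q hq] := dv.
  move: (nat_of_ord l) lM hq => l' lM hq.
  have : (q < 2)%N by rewrite -(ltn_pmul2r M0) -hq; lia.
  case: q hq => [|[|//]]; lia.
rewrite -(ler_pM2l (_ : 0 < M%:R)) ?ltr0n// -cabs_natr -cabsM -e.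
apply: le_trans (cabs_sum_le _ _) _.
rewrite cabs_natr mulr_natl -[X in _ *+ X]card_ord -sumr_const.
apply: ler_sum => i _.
by rewrite cabsM cabsX /w /unit_root cabs_cis expr1n mul1r cisX.
Qed.

(** The constant C disappears when n-th roots are taken. *)
Lemma le_of_exp_le (a B C : R) : 0 <= a -> 0 <= B ->
  (forall n, a ^+ n <= C * B ^+ n) -> a <= B.
Proof.
move=> a0 B0 h; rewrite leNgt; apply/negP => Ba.
have [B_eq0|Bn0] := eqVneq B 0.
  by have := h 1%N; rewrite !expr1 B_eq0 mulr0 leNgt -B_eq0 Ba.
have Bgt0 : 0 < B by rewrite lt_neqAle eq_sym Bn0.
pose e := a / B - 1.
have e0 : 0 < e by rewrite subr_gt0 ltr_pdivlMr// mul1r.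
have bernoulli n : 1 + n%:R * e <= (a / B) ^+ n.
  elim: n => [|n IHn]; first by rewrite mul0r addr0.
  have aBE : a / B = 1 + e by rewrite /e; ring.
  move: IHn; rewrite aBE => IHn; clearbody e.
  rewrite exprS -natr1; have n0 : 0 <= n%:R * e ^+ 2 by rewrite mulr_ge0 ?sqr_ge0.
  have e1 : 0 <= 1 + e by lra.
  by have := ler_wpM2l e1 IHn; lra.
pose n := (Num.truncn (C / e)).+1.
have : C / e < n%:R by exact: truncnS_gt.
rewrite ltr_pdivrMr// => Cn.
have := h n; rewrite -ler_pdivrMr ?exprn_gt0// -expr_div_n.
by have := bernoulli n; lra.
Qed.

(** The maximum principle on discs: the coefficients of p ^ n are at most B ^ n,
    so |p z| ^ n <= B ^ n / (1 - |z|) for every n. *)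
Lemma maximum_principle p B z : (forall x, cabs p.[cis x] <= B) -> cabs z < 1 ->
  cabs p.[z] <= B.
Proof.
move=> pB z1; have B0 : 0 <= B by apply: le_trans (pB 0); exact: cabs_ge0.
apply: (@le_of_exp_le _ _ (1 - cabs z)^-1) => // [|n]; first exact: cabs_ge0.
have coefB : forall j, cabs (p ^+ n)`_j <= B ^+ n.
  apply: coef_le_circle => x; rewrite horner_exp cabsX.
  by rewrite lerXn2r ?nnegrE ?cabs_ge0.
rewrite -cabsX -horner_exp horner_coef mulrC.
apply: le_trans (cabs_sum_le _ _) _.
have sub1 : 0 < 1 - cabs z by rewrite subr_gt0.
rewrite ler_pdivlMr// mulr_suml.
set s := size _.
apply: (@le_trans _ _ (\sum_(i < s) B ^+ n * (cabs z ^+ i * (1 - cabs z)))).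
  apply: ler_sum => i _; rewrite cabsM cabsX -mulrA ler_wpM2r//.
  by rewrite mulr_ge0 ?exprn_ge0 ?cabs_ge0// ltW.
rewrite -mulr_sumr -mulr_suml -[leRHS]mulr1 ler_wpM2l ?exprn_ge0//.
rewrite mulrC -opprB mulNr -subrX1 opprB gerBl exprn_ge0//; exact: cabs_ge0.
Qed.

End UnitCircle.
(** * Power sums of points on the circle *)

Section PowerSums.
Variable R : realType.
Implicit Types (x y c rho u H : R) (th : seq R).

(** The squared distance between rho (cos x + i sin x) and 1. *)
Definition chord2 rho x : R := 1 - 2 * rho * cos x + rho ^+ 2.

Lemma chord2_ge rho x : 0 <= rho -> (1 - rho) ^+ 2 <= chord2 rho x.
Proof.
move=> r0; rewrite -subr_ge0.
have -> : chord2 rho x - (1 - rho) ^+ 2 = 2 * rho * (1 - cos x).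
  by rewrite /chord2; ring.
by rewrite !mulr_ge0// subr_ge0 cos_le1.
Qed.

Lemma cabs_sub_cis rho x y :
  cabs (rho%:C * cis x - cis y) ^+ 2 = chord2 rho (x - y).
Proof.
rewrite cabs_sqr /cis /chord2 cosB; simpc => /=.
have := cos2Dsin2 x; have := cos2Dsin2 y.
set cx := cos x; set cy := cos y; set sx := sin x; set sy := sin y => ey ex.
transitivity (rho ^+ 2 * (cx ^+ 2 + sx ^+ 2) + (cy ^+ 2 + sy ^+ 2)
  - 2 * rho * (cx * cy + sx * sy)); first by ring.
by rewrite ex ey; ring.
Qed.

Lemma geometric_cos_sum u x L :
  chord2 u x * \sum_(l < L) u ^+ l * cos (l.+1%:R * x) =
  cos x - u - u ^+ L * cos (L.+1%:R * x) + u ^+ L.+1 * cos (L%:R * x).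
Proof.
elim: L => [|L IHL].
  by rewrite big_ord0 expr0 mulr0 !mul1r mul0r cos0 expr1 mulr1; ring.
rewrite big_ord_recr/= mulrDr IHL.
set v := L.+1%:R * x.
have -> : L.+2%:R * x = v + x by rewrite -natr1 mulrDl mul1r.
have -> : L%:R * x = v - x by rewrite /v -natr1 mulrDl mul1r addrK.
by rewrite /chord2 !cosD cosN sinN !exprS; ring.
Qed.

(** The truncated series of log |1 - w|, with the remainder estimated by
    differentiating along the ray of w. *)
Lemma ln_chord2_ge rho x L : 0 <= rho < 1 ->
  - \sum_(l < L) rho ^+ l.+1 * (cos (l.+1%:R * x) / l.+1%:R) -
    2 * rho ^+ L.+1 / (1 - rho) ^+ 2 <= 2^-1 * ln (chord2 rho x).
Proof.
move=> /andP[r0 r1].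
have c0 u : 0 <= u <= rho -> 0 < chord2 u x.
  move=> /andP[u0 ur]; apply: lt_le_trans (chord2_ge x u0).
  by rewrite exprn_gt0//; lra.
pose f u := 2^-1 * ln (chord2 u x) +
  \sum_(l < L) (cos (l.+1%:R * x) / l.+1%:R) * u ^+ l.+1.
pose df u := 2^-1 * ((chord2 u x)^-1 * (- (2 * cos x) + 2%:R * u ^+ 1)) +
  \sum_(l < L) (cos (l.+1%:R * x) / l.+1%:R) * (l.+1%:R * u ^+ l).
have fd u : 0 <= u <= rho -> is_derive u 1 f (df u).
  move=> u0; apply: is_derive_addf.
    apply: is_derive_scalef.
    have cd : is_derive u 1 (fun y => chord2 y x) (- (2 * cos x) + 2%:R * u ^+ 1).
      have -> : (fun y => chord2 y x) = (fun y => - (2 * cos x) * y + 1 + y ^+ 2).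
        by apply/funext => y; rewrite /chord2; ring.
      exact: (is_derive_addf (is_derive_affine _ _ _) (is_derive_expf 2 u)).
    exact: (is_derive_compf (f := @ln R) (g := fun y => chord2 y x)
      (is_derive1_ln (c0 u u0)) cd).
  apply: is_derive_sumf => l; apply: is_derive_scalef; exact: is_derive_expf.
have dfE u : 0 <= u <= rho -> df u =
    u ^+ L * (u * cos (L%:R * x) - cos (L.+1%:R * x)) / chord2 u x.
  move=> u0; apply: (mulfI (lt0r_neq0 (c0 u u0))).
  rewrite [RHS]mulrC divfK ?lt0r_neq0 ?c0// /df mulrDr.
  have -> : \sum_(l < L) cos (l.+1%:R * x) / l.+1%:R * (l.+1%:R * u ^+ l) =
      \sum_(l < L) u ^+ l * cos (l.+1%:R * x).
    by apply: eq_bigr => l _; rewrite mulrA divfK ?pnatr_eq0// mulrC.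
  rewrite geometric_cos_sum mulrCA mulVKf ?lt0r_neq0 ?c0// expr1 exprS.
  move: (cos (L%:R * x)) (cos (L.+1%:R * x)) (u ^+ L) (cos x) => a b e d.
  by field.
have r1' : 0 < 1 - rho by lra.
have /= := @derive_ge_increment R f df 0 rho
  (- (2 * rho ^+ L / (1 - rho) ^+ 2)) r0 fd.
have f0 : f 0 = 0.
  rewrite /f /chord2 big1 => [|l _]; last by rewrite expr0n mulr0.
  by rewrite mulr0 mul0r subr0 expr0n/= !addr0 ln1 mulr0.
rewrite f0 !subr0 => h.
have /h : forall u, 0 <= u <= rho -> - (2 * rho ^+ L / (1 - rho) ^+ 2) <= df u.
  move=> u u0; rewrite dfE// -mulNr ler_pdivlMr ?c0// mulrAC ler_pdivrMr ?exprn_gt0//.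
  have /andP[u0' ur] := u0.
  have h1 : (1 - rho) ^+ 2 <= chord2 u x.
    apply: le_trans (chord2_ge x u0').
    by rewrite lerXn2r ?nnegrE//; lra.
  have h2 : u ^+ L <= rho ^+ L by rewrite lerXn2r ?nnegrE.
  have h3 : - 2 <= u * cos (L%:R * x) - cos (L.+1%:R * x).
    have := cos_geN1 (L%:R * x); have := cos_le1 (L.+1%:R * x).
    by nra.
  have h4 : 0 <= u ^+ L by rewrite exprn_ge0.
  have h5 : 0 <= (1 - rho) ^+ 2 by rewrite sqr_ge0.
  have h6 : - 2 * rho ^+ L <= u ^+ L * (u * cos (L%:R * x) - cos (L.+1%:R * x)).
    by nra.
  have h7 : 0 <= rho ^+ L by rewrite exprn_ge0.
  move: h1 h5 h6 h7.
  move: (u ^+ L * _) (rho ^+ L) ((1 - rho) ^+ 2) (chord2 u x) => a b e d.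
  by nra.
have -> : \sum_(l < L) rho ^+ l.+1 * (cos (l.+1%:R * x) / l.+1%:R) =
    \sum_(l < L) (cos (l.+1%:R * x) / l.+1%:R) * rho ^+ l.+1.
  by apply: eq_bigr => l _; rewrite mulrC.
rewrite /f [rho ^+ L.+1]exprS.
set S := \sum_(l < L) _; move: ((1 - rho) ^- 2) (rho ^+ L) (ln _) => a b e.
by lra.
Qed.

Lemma sum_cos_roots M m c : (0 < m < M)%N ->
  \sum_(i < M) cos (m%:R * (i%:R * (pi *+ 2 / M%:R)) + c) = 0.
Proof.
move=> /andP[m0 mM].
have M0 : (0 < M)%N by exact: leq_trans mM.
have := sum_prim_root_powers m (@unit_root_primitive R M M0).
rewrite gtnNdvd// => e.
have -> : \sum_(i < M) cos (m%:R * (i%:R * (pi *+ 2 / M%:R)) + c) =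
    complex.Re (cis c * \sum_(i < M) unit_root R M ^+ m ^+ i); last by rewrite e mulr0.
rewrite mulr_sumr raddf_sum/=; apply: eq_bigr => i _.
by rewrite -exprM mulnC exprM !cisX -cisD addrC.
Qed.

Lemma sum_cos_mul_roots M k l c x : (0 < k)%N -> (0 < l)%N -> (k + l < M)%N ->
  let psi i := i%:R * (pi *+ 2 / M%:R) in
  \sum_(i < M) cos (k%:R * (psi i - c)) * cos (l%:R * (psi i - x)) =
  if k == l then M%:R / 2 * cos (k%:R * (x - c)) else 0.
Proof.
move=> k0 l0 klM psi.
have prodE i : cos (k%:R * (psi i - c)) * cos (l%:R * (psi i - x)) =
    2^-1 * (cos ((k + l)%:R * psi i + - (k%:R * c + l%:R * x)) +
            cos (k%:R * psi i - l%:R * psi i + (l%:R * x - k%:R * c))).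
  have -> : (k + l)%:R * psi i + - (k%:R * c + l%:R * x) =
      k%:R * (psi i - c) + l%:R * (psi i - x) by rewrite natrD; ring.
  have -> : k%:R * psi i - l%:R * psi i + (l%:R * x - k%:R * c) =
      k%:R * (psi i - c) - l%:R * (psi i - x) by ring.
  by rewrite cosD cosB; field.
under eq_bigr do rewrite prodE.
rewrite -mulr_sumr big_split/= sum_cos_roots ?klM ?addn_gt0 ?k0// add0r.
case: ltngtP => [kl|lk|->].
- under eq_bigr => i _.
    rewrite -cosN opprD opprB -mulrBl -natrB 1?ltnW//.
    over.
  by rewrite sum_cos_roots ?mulr0//; lia.
- under eq_bigr => i _.
    rewrite -mulrBl -natrB 1?ltnW//.
    over.
  by rewrite sum_cos_roots ?mulr0//; lia.
under eq_bigr do rewrite subrr add0r -mulrBr.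
by rewrite sumr_const card_ord -mulr_natl; ring.
Qed.

Lemma sum_ln_chord2_le th H rho psi :
  (forall x, \prod_(y <- th) cabs (cis x - cis y) <= expR H) -> 0 <= rho < 1 ->
  \sum_(y <- th) 2^-1 * ln (chord2 rho (psi - y)) <= H.
Proof.
move=> hH /andP[r0 r1].
pose Q : {poly R[i]} := \prod_(y <- th) ('X - (cis y)%:P).
have QE z : cabs Q.[z] = \prod_(y <- th) cabs (z - cis y).
  rewrite horner_prod cabs_prod; apply: eq_bigr => y _; by rewrite hornerXsubC.
have : cabs Q.[rho%:C * cis psi] <= expR H.
  apply: maximum_principle => [x|]; first by rewrite QE.
  by rewrite cabsM cabs_cis mulr1 cabs_real.
rewrite QE => h; rewrite -ler_expR expR_sum; apply: le_trans h.
suff : forall y, expR (2^-1 * ln (chord2 rho (psi - y))) =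
    cabs (rho%:C * cis psi - cis y).
  by move=> e; under eq_bigr do rewrite e.
move=> y.
have c0 : 0 < cabs (rho%:C * cis psi - cis y).
  rewrite lt_neqAle cabs_ge0 andbT eq_sym -sqrf_eq0 cabs_sub_cis.
  by apply/lt0r_neq0/(lt_le_trans _ (chord2_ge _ r0)); rewrite exprn_gt0// subr_gt0.
rewrite -cabs_sub_cis lnXn// -[ln _ *+ 2]mulr_natl mulKf//.
by rewrite lnK.
Qed.

Lemma expr_small rho e : 0 <= rho < 1 -> 0 < e -> exists n, rho ^+ n <= e.
Proof.
move=> /andP[r0 r1] e0; apply/not_existsP => h.
have : 1 <= rho :> R; last by rewrite leNgt r1.
apply: (@le_of_exp_le R _ _ e^-1) => // n.
rewrite expr1n ler_pdivlMl// mulr1.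
by have /negP := h n; rewrite -ltNge => /ltW.
Qed.

(** Test log |Q| on the circle of radius rho, where Q has its zeros at the points of
    the unit circle, against the weights 1 - cos (k (psi - c)) at the M-th roots of
    unity. As M > L + k, the average kills every term of the truncated series of
    log |Q| except the k-th, and the maximum principle bounds log |Q| by H. *)
Lemma power_sum_disc th H k c rho L : (0 < k)%N ->
  (forall x, \prod_(y <- th) cabs (cis x - cis y) <= expR H) -> 0 <= rho < 1 ->
  (k <= L)%N ->
  rho ^+ k * \sum_(x <- th) cos (k%:R * (x - c)) <=
  2 * k%:R * H + (size th)%:R * (8 * k%:R * rho ^+ L.+1 / (1 - rho) ^+ 2).
Proof.
move=> k0 hH r01 kL.
have /andP[r0 r1] := r01.
pose M := (L + k).+1.
pose psi (i : nat) : R := i%:R * (pi *+ 2 / M%:R).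
pose w (i : nat) := 1 - cos (k%:R * (psi i - c)).
have w0 i : 0 <= w i by rewrite subr_ge0 cos_le1.
have w2 i : w i <= 2 by have := cos_geN1 (k%:R * (psi i - c)); rewrite /w; lra.
have M0 : 0 < M%:R :> R by rewrite ltr0n.
have k0' : 0 < k%:R :> R by rewrite ltr0n.
have cos0 l a : (0 < l < M)%N -> \sum_(i < M) cos (l%:R * (psi i - a)) = 0.
  move=> lM; have := sum_cos_roots (- (l%:R * a)) lM => e.
  by rewrite -[RHS]e; apply: eq_bigr => i _; rewrite mulrBr.
have w_sum : \sum_(i < M) w i = M%:R.
  rewrite sumrB cos0 ?subr0 ?sumr_const ?card_ord//.
  by rewrite k0 /M ltnS leq_addl.
pose err := 2 * rho ^+ L.+1 / (1 - rho) ^+ 2.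
have err0 : 0 <= err by rewrite !mulr_ge0 ?exprn_ge0 ?invr_ge0 ?sqr_ge0.
pose logc x (i : nat) := 2^-1 * ln (chord2 rho (psi i - x)).
pose ser x (i : nat) :=
  \sum_(l < L) rho ^+ l.+1 * (cos (l.+1%:R * (psi i - x)) / l.+1%:R).
have upper : \sum_(i < M) w i * \sum_(x <- th) logc x i <= M%:R * H.
  rewrite -w_sum mulr_suml; apply: ler_sum => i _.
  by rewrite ler_wpM2l// sum_ln_chord2_le.
have ser_sum x : \sum_(i < M) w i * ser x i =
    - (M%:R / 2 * rho ^+ k / k%:R * cos (k%:R * (x - c))).
  transitivity (\sum_(l < L) rho ^+ l.+1 / l.+1%:R *
      \sum_(i < M) w i * cos (l.+1%:R * (psi i - x))).
    under eq_bigr do rewrite mulr_sumr.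
    rewrite exchange_big/=; apply: eq_bigr => l _; rewrite mulr_sumr.
    by apply: eq_bigr => i _; ring.
  have inner (l : 'I_L) : \sum_(i < M) w i * cos (l.+1%:R * (psi i - x)) =
      - (if k == l.+1 then M%:R / 2 * cos (k%:R * (x - c)) else 0).
    have lM : (k + l.+1 < M)%N by rewrite /M ltnS addnC leq_add2r.
    under eq_bigr do rewrite mulrBl mul1r.
    rewrite sumrB cos0 ?sub0r; last by rewrite /= (leq_ltn_trans _ lM) ?leq_addl.
    by congr (- _); exact: (@sum_cos_mul_roots M k l.+1 c x k0 isT lM).
  under eq_bigr do rewrite inner.
  have k1 : (k.-1 < L)%N by rewrite prednK.
  rewrite (bigD1 (Ordinal k1))//= prednK// eqxx big1 ?addr0; last first.
    move=> l lk; case: eqP; last by rewrite oppr0 mulr0.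
    move=> kE; case/eqP: lk; apply/val_inj => /=; by rewrite kE.
  by field; rewrite lt0r_neq0.
have lower x : M%:R / 2 * rho ^+ k / k%:R * cos (k%:R * (x - c)) - 2 * M%:R * err
    <= \sum_(i < M) w i * logc x i.
  rewrite -[X in X - _]opprK -ser_sum.
  have -> : 2 * M%:R * err = \sum_(i < M) 2 * err.
    by rewrite sumr_const card_ord -mulr_natl; ring.
  rewrite -sumrN -sumrB; apply: ler_sum => i _.
  have := @ln_chord2_ge rho (psi i - x) L r01; rewrite -/(ser x i) -/err -/(logc x i).
  by have := w0 i; have := w2 i; move: (w i) (ser x i) (logc x i) => a b d; nra.
have : \sum_(x <- th) (M%:R / 2 * rho ^+ k / k%:R * cos (k%:R * (x - c)) -
    2 * M%:R * err) <= M%:R * H.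
  apply: le_trans upper; under [leRHS]eq_bigr do rewrite mulr_sumr.
  by rewrite exchange_big; apply: ler_sum => x _; exact: lower.
rewrite sumrB -mulr_sumr sum_const_seq.
set S := \sum_(x <- th) _.
have -> : 8 * k%:R * rho ^+ L.+1 / (1 - rho) ^+ 2 = 4 * k%:R * err.
  by rewrite /err; ring.
move=> h; rewrite -(ler_pM2l (divr_gt0 M0 (mulr_gt0 (ltr0n _ 2) k0'))).
apply: le_trans (_ : M%:R / (2 * k%:R) * (rho ^+ k * S) <= M%:R * H +
    (size th)%:R * (2 * M%:R * err)) _.
  rewrite -lerBlDr; apply: le_trans h; rewrite le_eqVlt; apply/orP; left; apply/eqP.
  by field; rewrite lt0r_neq0.
rewrite le_eqVlt; apply/orP; left; apply/eqP.
by field; rewrite lt0r_neq0.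
Qed.

(** Caratheodory's coefficient inequality for the logarithm of the polynomial with
    zeros on the circle: its real part is at most H in the disc and vanishes at 0, and
    its k-th coefficient is, up to sign, the k-th power sum of the conjugate zeros
    divided by k. The proof lets L tend to infinity and rho to 1 in
    [power_sum_disc]. *)
Lemma power_sum_le th H k c : (0 < k)%N ->
  (forall x, \prod_(y <- th) cabs (cis x - cis y) <= expR H) ->
  \sum_(x <- th) cos (k%:R * (x - c)) <= 2 * k%:R * H.
Proof.
move=> k0 hH; apply/ler_addgt0Pr => e e0.
set S := \sum_(x <- th) _; set N : R := (size th)%:R.
have N0 : 0 <= N by rewrite ler0n.
have SN : S <= N.
  by rewrite -[N]mulr1 -sum_const_seq; apply: ler_sum => x _; exact: cos_le1.
have k0' : 0 < k%:R :> R by rewrite ltr0n.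
(* rho is 1 - h; replacing rho ^ k by 1 costs at most e / 2. *)
pose h : R := Num.min 1 (e / (2 * (k%:R * N + 1))).
have d0 : 0 < 2 * (k%:R * N + 1) by have := mulr_ge0 (ltW k0') N0; lra.
have h0 : 0 < h by rewrite lt_min ltr01 divr_gt0.
have h1 : h <= 1 by rewrite ge_min lexx.
have hN : k%:R * N * h <= e / 2.
  have : h <= e / (2 * (k%:R * N + 1)) by rewrite ge_min lexx orbT.
  by rewrite ler_pdivlMr//; clearbody h; nra.
have bernoulli n : 1 - n%:R * h <= (1 - h) ^+ n.
  elim: n => [|n IHn]; first by rewrite mul0r subr0.
  rewrite exprS -natr1; have n0 : 0 <= n%:R * h ^+ 2 by rewrite mulr_ge0 ?sqr_ge0.
  have h1' : 0 <= 1 - h by rewrite subr_ge0.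
  by have := ler_wpM2l h1' IHn; clearbody h; lra.
have r01 : 0 <= 1 - h < 1 by apply/andP; split; clearbody h; lra.
have den0 : 0 < 16 * k%:R * (N + 1) by rewrite mulr_gt0 ?mulr_gt0//; lra.
have [n hn] := expr_small r01 (divr_gt0 (mulr_gt0 e0 (exprn_gt0 2 h0)) den0).
have := power_sum_disc c k0 hH r01 (leq_maxr n k).
rewrite -/S -/N subKr.
have hn' : (1 - h) ^+ (maxn n k).+1 <= e * h ^+ 2 / (16 * k%:R * (N + 1)).
  apply: le_trans hn; apply: ler_wiXn2l; [lra|lra|].
  by rewrite ltnW// ltnS leq_maxl.
have errle : N * (8 * k%:R * (1 - h) ^+ (maxn n k).+1 / h ^+ 2) <= e / 2.
  move: hn'; rewrite ler_pdivlMr//.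
  have : 0 <= (1 - h) ^+ (maxn n k).+1 by rewrite exprn_ge0//; lra.
  move: (_ ^+ (maxn n k).+1) => q q0 hq.
  rewrite mulrA ler_pdivrMr ?exprn_gt0//.
  by have := mulr_ge0 (ltW k0') q0; lra.
have : S - (1 - h) ^+ k * S <= e / 2.
  apply: le_trans hN; rewrite -[X in X - _]mul1r -mulrBl.
  have b1 : (1 - h) ^+ k <= 1 by rewrite exprn_ile1//; lra.
  have := bernoulli k; move: (_ ^+ k) b1 => q q1 qk.
  by nra.
by clearbody S N h; lra.
Qed.

End PowerSums.
(** * The discrepancy constant *)

Section Catalan.
Variable R : realType.

Let term (k : nat) : R := (-1) ^+ k / (k.*2.+1)%:R ^+ 2.

(** The absolute values telescope: the k-th is at most 2 / ((k + 1) (k + 2)). *)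
Lemma catalan_series_cvg : cvgn (series term).
Proof.
apply: normed_cvg; apply: nondecreasing_is_cvgn.
  apply: nondecreasing_series => k _ _; exact: normr_ge0.
exists 2 => _ [n _ <-]; rewrite /series/=.
suff : \sum_(0 <= k < n) `|term k| <= 2 - 2 / n.+1%:R.
  by move=> /le_trans; apply; rewrite gerBl divr_ge0.
elim: n => [|n IHn]; first by rewrite big_geq// divr1 subrr.
rewrite big_nat_recr//=; apply: le_trans (lerD IHn (lexx _)) _.
rewrite /term normrM normrX normrN1 expr1n mul1r ger0_norm ?invr_ge0 ?exprn_ge0//.
have -> : n.*2.+1%:R = 2 * n%:R + 1 :> R by rewrite -[LHS]natr1 -mul2n natrM.
rewrite -[n.+2%:R]natr1 -[n.+1%:R]natr1.
have n0 : 0 <= n%:R :> R by [].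
move: (n%:R : R) n0 => x x0.
have d1 : 0 < (2 * x + 1) ^+ 2 by rewrite exprn_gt0//; lra.
rewrite -subr_ge0.
have -> : 2 - 2 / (x + 1 + 1) - (2 - 2 / (x + 1) + ((2 * x + 1) ^+ 2)^-1) =
  (7 * x ^+ 2 + 5 * x) / ((x + 1) * (x + 1 + 1) * (2 * x + 1) ^+ 2).
  by field; rewrite !lt0r_neq0//; lra.
by apply: divr_ge0; [nra|apply: mulr_ge0 (ltW d1); apply: mulr_ge0; lra].
Qed.

(** The partial sums alternate around the limit, from the first two, 1 and 8 / 9. *)
Lemma catalan_bounds : 0 < catalan R /\ catalan R <= 1.
Proof.
have step (k : nat) : 0 <= (k.*2.+1)%:R ^- 2 - (k.+1.*2.+1)%:R ^- 2 :> R.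
  rewrite subr_ge0 lef_pV2 ?posrE ?exprn_gt0 ?ltr0n//.
  by rewrite lerXn2r ?nnegrE// ler_nat; lia.
have sgnD (k : nat) : ((-1) ^+ k.*2 = 1 :> R) * ((-1) ^+ k.*2.+1 = -1 :> R).
  by rewrite exprS -mul2n exprM sqrrN expr1n expr1n mulr1.
have odd_even (m : nat) : [/\ series term m.*2.+1 <= 1,
    8 / 9 <= series term m.*2.+2 & series term m.*2.+2 <= series term m.*2.+1].
  have s n : series term n.+1 = series term n + term n by rewrite seriesSr.
  elim: m => [|m [odd_le even_ge _]].
    have s0 : series term 0 = 0 by rewrite /series/= big_geq.
    have t0 : term 0 = 1 by rewrite /term expr0 expr1n divr1.
    have t1 : term 1 = - (9^-1) by rewrite /term expr1 mulN1r; rewrite -natrX.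
    by rewrite !s s0 t0 t1; split; lra.
  have -> : m.+1.*2 = m.*2.+2 by rewrite doubleS.
  have e2 : term m.*2.+2 = (m.*2.+2.*2.+1)%:R ^- 2.
    by rewrite /term -doubleS sgnD mul1r.
  have e1 : term m.*2.+1 = - (m.*2.+1.*2.+1)%:R ^- 2 by rewrite /term sgnD mulN1r.
  have e3 : term m.*2.+3 = - (m.*2.+3.*2.+1)%:R ^- 2.
    by rewrite /term -doubleS sgnD mulN1r.
  have := step m.*2.+1; have := step m.*2.+2.
  move: odd_le even_ge; rewrite (s m.*2.+3) (s m.*2.+2) (s m.*2.+1) e1 e2 e3.
  have : 0 <= (m.*2.+3.*2.+1)%:R ^- 2 :> R by rewrite invr_ge0 exprn_ge0.
  move: (series term _) (m.*2.+1.*2.+1%:R ^- 2 : R) (m.*2.+2.*2.+1%:R ^- 2 : R)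
    (m.*2.+3.*2.+1%:R ^- 2 : R) => w x y z *.
  by split; lra.
have bounds n : 8 / 9 <= series term n.+1 <= 1.
  have [s1 s2 s21] := odd_even n./2; have := odd_double_half n.
  case: (odd n) => /= <-; rewrite ?add0n ?add1n; first by rewrite s2 (le_trans s21).
  by rewrite s1 (le_trans s2).
have c := catalan_series_cvg; split.
  apply: (@lt_le_trans _ _ (8 / 9)); first by lra.
  apply: limr_ge => //; near=> n.
  by have /andP[] := bounds n.-1; rewrite prednK//; near: n; exists 1%N.
apply: limr_le => //; near=> n.
by have /andP[] := bounds n.-1; rewrite prednK//; near: n; exists 1%N.
Unshelve. all: by end_near.
Qed.

(** The constant produced by the Erdos-Turan argument is 4 / sqrt pi; it is below
    the one in the theorem because 8 <= pi ^ 2 and Catalan's constant is at most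
    1. *)
Lemma four_div_sqrt_pi_le :
  4 / Num.sqrt pi <= Num.sqrt (pi *+ 2 / catalan R).
Proof.
have [c0 c1] := catalan_bounds; have pi0 := pi_gt0 R.
have sp0 : 0 < Num.sqrt (pi : R) by rewrite sqrtr_gt0.
have q0 : 0 <= pi *+ 2 / catalan R :> R.
  by apply: divr_ge0; [rewrite mulrn_wge0// pi_ge0|exact: ltW].
rewrite ler_pdivrMr// -sqrtrM// -[leLHS]ger0_norm// -sqrtr_sqr ler_wsqrtr//.
have := pi_sqr_ge8 R; move: (pi) (catalan R) c0 c1 pi0 => p c c0 c1 p0 p8.
rewrite mulrAC ler_pdivlMr// mulr2n; nra.
Qed.

End Catalan.
(** * Discrepancy of the arguments of the zeros *)

Section Discrepancy.
Variable R : realType.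
Implicit Types (x y a b r H B : R) (th : seq R) (z : R[i]) (p : {poly R[i]}).

(** The Erdos-Turan inequality with delta = 2 s sqrt pi, for s slightly above
    sqrt (H / N); beyond delta = pi the bound is trivial. *)
Lemma angular_upper th H a b : (0 < size th)%N -> 0 <= H ->
  (forall x, \prod_(y <- th) cabs (cis x - cis y) <= expR H) -> a <= b ->
  \sum_(x <- th) (a <= x <= b)%R%:R <= (size th)%:R *
    ((b - a) / (pi *+ 2) + 4 / Num.sqrt pi * Num.sqrt (H / (size th)%:R)).
Proof.
move=> N0 H0 hH ab; have -> : (pi : R) *+ 2 = 2 * pi by rewrite mulr_natl.
set N : R := (size th)%:R.
have N0' : 0 < N by rewrite ltr0n.
set C := \sum_(x <- th) _.
have CN : C <= N.
  rewrite -[N]mulr1 -sum_const_seq; apply: ler_sum => x _.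
  by rewrite -[1]/(1%:R) ler_nat leq_b1.
have pi0 := pi_gt0 R; have q0 : 0 < Num.sqrt (pi : R) by rewrite sqrtr_gt0.
have qq : Num.sqrt pi * Num.sqrt pi = pi :> R by rewrite -expr2 sqr_sqrtr// ltW.
have s_bound s : 0 < s -> H / N <= s ^+ 2 ->
    C <= N * ((b - a) / (2 * pi) + 4 / Num.sqrt pi * s).
  move=> s0 Hs.
  have ba0 : 0 <= (b - a) / (2 * pi).
    by apply: divr_ge0; [rewrite subr_ge0|rewrite mulr_ge0// pi_ge0].
  have [dpi|dpi] := leP (2 * s * Num.sqrt pi) pi; last first.
    apply: le_trans CN _; rewrite -[leLHS]mulr1 ler_pM2l//.
    suff : 1 <= 4 / Num.sqrt pi * s by lra.
    rewrite mulrAC ler_pdivlMr// mul1r.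
    move: dpi; rewrite -{1}qq; move: (Num.sqrt _) q0 => q q0.
    by rewrite ltr_pM2r// => dpi; lra.
  have d0 : 0 < 2 * s * Num.sqrt pi by rewrite !mulr_gt0.
  have := @erdos_turan R th H (2 * s * Num.sqrt pi) a b H0
    (fun k c k0 => power_sum_le c k0 hH) _ ab.
  rewrite d0 dpi => /(_ isT); rewrite -/N -/C => h; apply: le_trans h _.
  have HsN : H <= s ^+ 2 * N by rewrite -ler_pdivrMr.
  have : 4 * H / (2 * s * Num.sqrt pi) <= N * (2 / Num.sqrt pi * s).
    rewrite ler_pdivrMr//.
    have -> : N * (2 / Num.sqrt pi * s) * (2 * s * Num.sqrt pi) = 4 * (s ^+ 2 * N).
      by move: (Num.sqrt _) q0 => q q0; field; rewrite lt0r_neq0.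
    by rewrite ler_pM2l.
  have -> : N * (2 * s * Num.sqrt pi) / pi = N * (2 / Num.sqrt pi * s).
    by rewrite -{2}qq; move: (Num.sqrt _) q0 => q q0; field; rewrite lt0r_neq0.
  have -> : N * (b - a) / (2 * pi) = N * ((b - a) / (2 * pi)) by rewrite mulrA.
  move: (_ / (2 * pi)) (Num.sqrt _) (4 * H / _) => u q v.
  by lra.
apply/ler_addgt0Pr => e e0.
pose e' := e / (N * (4 / Num.sqrt pi)).
have den0 : 0 < N * (4 / Num.sqrt pi) by rewrite mulr_gt0// divr_gt0.
have e'0 : 0 < e' by rewrite divr_gt0.
have HN : 0 <= H / N by rewrite divr_ge0// ltW.
have sq0 := sqrtr_ge0 (H / N).
have := s_bound (Num.sqrt (H / N) + e').
rewrite ltr_wpDl// => /(_ isT); have -> : H / N <= (Num.sqrt (H / N) + e') ^+ 2.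
  by rewrite -{1}(sqr_sqrtr HN) lerXn2r ?nnegrE ?addr_ge0 ?(ltW e'0)// lerDl ltW.
move=> /(_ isT) h; apply: le_trans h _.
have <- : N * (4 / Num.sqrt pi) * e' = e by rewrite /e' mulrC divfK// gt_eqF.
by lra.
Qed.

Lemma cisD2pi x : cis (x + pi *+ 2) = cis x :> R[i].
Proof. by rewrite /cis cosD2pi sinD2pi. Qed.

(** The lower bound is the upper bound for the complementary arc, after moving the
    points of [0, a) by one turn. *)
Lemma angular_discrepancy th H a b : (0 < size th)%N -> 0 <= H ->
  (forall x, \prod_(y <- th) cabs (cis x - cis y) <= expR H) ->
  (forall x, x \in th -> 0 <= x < pi *+ 2) ->
  0 <= a -> a <= b -> b <= pi *+ 2 ->
  `|\sum_(x <- th) (a <= x < b)%R%:R - (size th)%:R * ((b - a) / (pi *+ 2))| <=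
  (size th)%:R * (4 / Num.sqrt pi * Num.sqrt (H / (size th)%:R)).
Proof.
move=> N0 H0 hH th01 a0 ab b2.
have up := angular_upper N0 H0 hH ab.
set N : R := (size th)%:R in up *; set E := 4 / _ * _ in up *.
have pi0 := pi_gt0 R.
have pi2 : 0 < (pi : R) *+ 2 by rewrite mulrn_wgt0.
pose turn x := if x < a then x + pi *+ 2 else x.
have hH' : forall x, \prod_(y <- map turn th) cabs (cis x - cis y) <= expR H.
  move=> x; rewrite big_map; apply: le_trans (hH x); apply: ler_prod => y _.
  by rewrite cabs_ge0 /turn; case: ifP; rewrite ?cisD2pi lexx.
have b_le : b <= a + pi *+ 2 by lra.
have := @angular_upper (map turn th) H b (a + pi *+ 2) _ H0 hH' b_le.
rewrite size_map => /(_ N0); rewrite -/N -/E => low.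
have cover : N <= \sum_(x <- th) (a <= x < b)%R%:R +
    \sum_(x <- map turn th) (b <= x <= a + pi *+ 2)%R%:R.
  rewrite big_map -big_split/= -[N]mulr1 -sum_const_seq.
  rewrite big_seq [leRHS]big_seq; apply: ler_sum => x /th01 /andP[x0 x2].
  rewrite /turn; case: (ltP x a) => xa.
    have -> : (b <= x + pi *+ 2 <= a + pi *+ 2) by apply/andP; split; lra.
    by rewrite /= add0r.
  case: (ltP x b) => xb /=; first by rewrite lerDl.
  have -> : x <= a + pi *+ 2 by lra.
  by rewrite add0r.
have sub : \sum_(x <- th) (a <= x < b)%R%:R <= \sum_(x <- th) (a <= x <= b)%R%:R :> R.
  apply: ler_sum => x _; rewrite ler_nat; case: (a <= x) => //=.
  by case: ltP => // /ltW ->.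
move: low; have -> : (a + pi *+ 2 - b) / (pi *+ 2) = 1 - (b - a) / (pi *+ 2) :> R.
  by move: (pi *+ 2) pi2 => t t0; field; rewrite lt0r_neq0.
rewrite ler_norml; move: up sub cover.
move: (\sum_(x <- th) _) (\sum_(x <- th) _) (\sum_(x <- map turn th) _) => s1 s2 s3.
move: ((b - a) / _) => q *; apply/andP; split; lra.
Qed.

(** ** Arguments *)

Lemma arg_exists z : exists t, is_arg z t.
Proof.
have pi0 := pi_gt0 R.
have [->|z0] := eqVneq z 0.
  exists 0; split; [exact: lexx|by rewrite mulrn_wgt0|].
  by rewrite cabs0 !mul0r.
have n0 : 0 < cabs z by rewrite cabs_gt0.
pose c := complex.Re z / cabs z; pose s := complex.Im z / cabs z.
have cs1 : c ^+ 2 + s ^+ 2 = 1.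
  rewrite /c /s !expr_div_n -mulrDl -cabs_sqr divff//.
  by rewrite sqrf_eq0 lt0r_neq0.
have zE : z = (cabs z * c) +i* (cabs z * s).
  by rewrite /c /s ![cabs z * _]mulrC !divfK ?lt0r_neq0//; case: (z).
have c1 : -1 <= c <= 1.
  rewrite -ler_norml -(expr_le1 (n := 2))// -normrX ger0_norm ?sqr_ge0//.
  by rewrite -cs1 lerDl sqr_ge0.
have cosc : cos (acos c) = c by rewrite acosK// in_itv.
have sinc : sin (acos c) = `|s|.
  by rewrite sin_acos// -cs1 addrAC subrr add0r sqrtr_sqr.
have [s0|s0] := leP 0 s.
  exists (acos c); split.
  - exact: acos_ge0.
  - by have := acos_lepi c1; rewrite mulr2n; lra.
  - by rewrite cosc sinc ger0_norm.
have a0 : 0 < acos c.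
  rewrite lt_neqAle acos_ge0// andbT eq_sym; apply: contraTneq s0 => a0.
  by rewrite -leNgt; move: sinc; rewrite a0 sin0 => /esym/normr0_eq0 ->.
exists (- acos c + pi *+ 2); split.
- by have := acos_lepi c1; rewrite mulr2n; lra.
- by rewrite mulr2n; lra.
- by rewrite cosD2pi sinD2pi cosN sinN cosc sinc ltr0_norm// opprK.
Qed.

Definition principal_arg z : R := projT1 (cid (arg_exists z)).

Lemma principal_argP z : is_arg z (principal_arg z).
Proof. exact: projT2 (cid (arg_exists z)). Qed.

Lemma polar z : z = (cabs z)%:C * cis (principal_arg z).
Proof.
have [_ _ {1}->] := principal_argP z.
by rewrite /cis; simpc.
Qed.

Lemma is_arg_unique z x y : z != 0 -> is_arg z x -> is_arg z y -> x = y.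
Proof.
move=> z0 [x0 x2 zx] [y0 y2 zy].
have n0 : cabs z != 0 by rewrite cabs_eq0.
have [cE sE] : cos x = cos y /\ sin x = sin y.
  by move: zx; rewrite {1}zy => -[/(mulfI n0) -> /(mulfI n0) ->].
have cos1 : cos (x - y) = 1 by rewrite cosB cE sE -!expr2 cos2Dsin2.
case: (ltgtP x y) => // xy.
- have /cos_lt1 : 0 < y - x < pi *+ 2 by apply/andP; split; lra.
  by rewrite -cosN opprB cos1 ltxx.
- have /cos_lt1 : 0 < x - y < pi *+ 2 by apply/andP; split; lra.
  by rewrite cos1 ltxx.
Qed.

Lemma annular_sectorE r a b z : z != 0 ->
  \1_(annular_sector r a b) z =
  (r < cabs z < r^-1)%R%:R * (a <= principal_arg z < b)%R%:R :> R.
Proof.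
move=> z0; rewrite indicE -natrM mulnb; congr (_ %:R); congr nat_of_bool.
apply/idP/idP.
  rewrite inE => -[-> -> [t tz tab]] /=.
  by rewrite -(is_arg_unique z0 tz (principal_argP z)).
move=> /andP[/andP[h1 h2] h3]; rewrite inE; split=> //.
by exists (principal_arg z) => //; exact: principal_argP.
Qed.

(** ** From polynomials to points on the circle *)

Lemma zerosE p : p = lead_coef p *: \prod_(z <- zeros p) ('X - z%:P).
Proof. by rewrite /zeros; case: closed_field_poly_normal. Qed.

Lemma cabs_horner p (y : R[i]) : cabs p.[y] =
  cabs (lead_coef p) * \prod_(z <- zeros p) cabs (y - z).
Proof.
rewrite {1}(zerosE p) hornerZ cabsM horner_prod cabs_prod; congr (_ * _).
by apply: eq_bigr => z _; rewrite hornerXsubC.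
Qed.

Lemma size_zeros p : p != 0 -> size (zeros p) = (size p).-1.
Proof.
move=> p0; rewrite {2}(zerosE p) size_scale ?lead_coef_eq0//.
by rewrite size_prod_XsubC.
Qed.

Lemma cabs_coef0 p : cabs p`_0 =
  cabs (lead_coef p) * \prod_(z <- zeros p) cabs z.
Proof.
rewrite -horner_coef0 cabs_horner; congr (_ * _); apply: eq_bigr => z _.
by rewrite sub0r cabsN.
Qed.

Lemma zeros_neq0 p z : p`_0 != 0 -> z \in zeros p -> z != 0.
Proof.
move=> p0 zp; apply: contraNneq p0 => z0; rewrite -cabs_eq0 cabs_coef0.
by rewrite (perm_big _ (perm_to_rem zp)) big_cons z0 cabs0 /=
  mul0r mulr0.
Qed.

(** After squaring, the two sides differ by (1 - |z|) ^ 2. This is what allows all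
    zeros to be moved radially to the unit circle. *)
Lemma schur_factor x z : Num.sqrt (cabs z) * cabs (cis x - cis (principal_arg z)) <=
  cabs (cis x - z).
Proof.
rewrite -(@ler_pXn2r _ 2)// ?nnegrE ?mulr_ge0 ?sqrtr_ge0 ?cabs_ge0//.
rewrite exprMn sqr_sqrtr ?cabs_ge0// -[cis x - _]opprB cabsN.
rewrite -[cis x - z]opprB cabsN {3}(polar z).
have := cabs_sub_cis 1 (principal_arg z) x; rewrite mul1r => ->.
rewrite cabs_sub_cis /chord2 -subr_ge0.
set c := cos _; set n := cabs z.
have -> : 1 - 2 * n * c + n ^+ 2 - n * (1 - 2 * 1 * c + 1 ^+ 2) = (1 - n) ^+ 2.
  by ring.
exact: sqr_ge0.
Qed.

(** The factors sqrt |z| multiply to sqrt (|a_0| / |a_n|). *)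
Lemma schur_bound p B : lead_coef p != 0 -> p`_0 != 0 ->
  (forall x, cabs p.[cis x] <= B) -> forall x,
  \prod_(y <- map principal_arg (zeros p)) cabs (cis x - cis y) <=
  expR (ln B - 2^-1 * ln (cabs (lead_coef p * p`_0))).
Proof.
move=> an0 a00 pB x; rewrite big_map.
set a := lead_coef p in an0 *.
have an : 0 < cabs a by rewrite cabs_gt0.
have a0 : 0 < cabs p`_0 by rewrite cabs_gt0.
have B0 : 0 < B.
  by apply: lt_le_trans (coef_le_circle pB 0); rewrite cabs_gt0.
set Q := \prod_(_ <- _) _.
have Q0 : 0 <= Q by apply: prodr_ge0 => z _; exact: cabs_ge0.
set m := cabs (a * p`_0).
have m0 : 0 < m by rewrite /m cabsM mulr_gt0.
have sm0 : 0 < Num.sqrt m by rewrite sqrtr_gt0.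
have -> : expR (ln B - 2^-1 * ln m) = B / Num.sqrt m.
  rewrite expRD lnK//; congr (_ * _); rewrite expRN; congr (_^-1).
  have {1}-> : m = Num.sqrt m ^+ 2 by rewrite sqr_sqrtr// ltW.
  by rewrite lnXn// -[ln _ *+ 2]mulr_natl mulKf// lnK.
rewrite ler_pdivlMr//; apply: le_trans (pB x); rewrite cabs_horner -/a.
have mE : Num.sqrt m = cabs a * \prod_(z <- zeros p) Num.sqrt (cabs z).
  have prod0 : 0 <= \prod_(z <- zeros p) Num.sqrt (cabs z).
    by apply: prodr_ge0 => z _; exact: sqrtr_ge0.
  rewrite -[RHS]ger0_norm ?mulr_ge0 ?(ltW an)// -sqrtr_sqr /m cabsM cabs_coef0 -/a.
  congr Num.sqrt; rewrite exprMn expr2 mulrA; congr (_ * _).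
  rewrite -prodrXl; apply: eq_bigr => z _.
  by rewrite sqr_sqrtr ?cabs_ge0.
rewrite mE mulrCA ler_pM2l// /Q -big_split/=; apply: ler_prod => z _.
by rewrite mulr_ge0 ?cabs_ge0 ?sqrtr_ge0//= mulrC schur_factor.
Qed.

(** Replacing the factor X - z by 1 - conj(z) X does not change the modulus on the
    circle; doing so for the zeros in the disc leaves a polynomial whose constant
    coefficient has modulus the left-hand side. *)
Lemma mahler_measure_le p B : (forall x, cabs p.[cis x] <= B) ->
  cabs (lead_coef p) * \prod_(z <- zeros p) Num.max 1 (cabs z) <= B.
Proof.
move=> pB.
pose F z : {poly R[i]} :=
  if 1 < cabs z then 'X - z%:P else 1 - (conjc z) *: 'X.
pose q := lead_coef p *: \prod_(z <- zeros p) F z.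
have qB x : cabs q.[cis x] <= B.
  apply: le_trans (pB x); rewrite [leRHS]cabs_horner hornerZ cabsM horner_prod cabs_prod.
  rewrite le_eqVlt; apply/orP; left; apply/eqP; congr (_ * _).
  apply: eq_bigr => z _; rewrite /F; case: ifP => _; first by rewrite hornerXsubC.
  rewrite hornerD hornerN hornerZ hornerX -polyC1 hornerC.
  apply/eqP; rewrite -(@eqrXn2 _ 2)// ?cabs_ge0// !cabs_sqr; case: z => u v.
  rewrite /cis; simpc => /=.
  have := cos2Dsin2 x; set c := cos x; set s := sin x => e.
  apply/eqP; transitivity (1 - 2 * (u * c + v * s) + (u ^+ 2 + v ^+ 2) *
    (c ^+ 2 + s ^+ 2)); first by ring.
  transitivity (c ^+ 2 + s ^+ 2 - 2 * (u * c + v * s) + (u ^+ 2 + v ^+ 2)).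
    by rewrite e; ring.
  by ring.
apply: le_trans (coef_le_circle qB 0).
rewrite -horner_coef0 hornerZ cabsM horner_prod cabs_prod.
rewrite le_eqVlt; apply/orP; left; apply/eqP; congr (_ * _).
apply: eq_bigr => z _; rewrite /F; case: ltP => h.
  by rewrite hornerXsubC sub0r cabsN.
rewrite hornerD hornerN hornerZ hornerX mulr0 subr0 -polyC1 hornerC.
by rewrite cabs1.
Qed.

(** A zero off the annulus has |log |z|| >= log (1 / r) >= 1 - r, and
    |log |z|| = 2 log (max 1 |z|) - log |z|; summed over the zeros, the first term is
    controlled by the Mahler measure and the second is log (|a_0| / |a_n|). *)
Lemma zeros_off_annulus p B r : 0 < r < 1 -> lead_coef p != 0 -> p`_0 != 0 ->
  (forall x, cabs p.[cis x] <= B) ->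
  (1 - r) * \sum_(z <- zeros p) (~~ (r < cabs z < r^-1)%R)%:R <=
  2 * (ln B - 2^-1 * ln (cabs (lead_coef p * p`_0))).
Proof.
move=> /andP[r0 r1] an0 a00 pB.
have an : 0 < cabs (lead_coef p) by rewrite cabs_gt0.
have a0 : 0 < cabs p`_0 by rewrite cabs_gt0.
have lnr : 1 - r <= - ln r.
  have /le_ln1Dx : -1 < r - 1 by lra.
  have -> : 1 + (r - 1) = r by ring.
  by lra.
have pointwise z : z \in zeros p ->
    (1 - r) * (~~ (r < cabs z < r^-1)%R)%:R <=
    2 * ln (Num.max 1 (cabs z)) - ln (cabs z).
  move=> /(zeros_neq0 a00); rewrite -cabs_gt0; move: (cabs z) => n n0.
  case: (ltP 1 n) => n1.
    have ln0 : 0 <= ln n by rewrite ln_ge0// ltW.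
    have [h|h] := boolP (r < n < r^-1); first by rewrite mulr0; lra.
    have h' : r^-1 <= n by move: h; rewrite (lt_trans r1 n1)/= -leNgt.
    have : ln r^-1 <= ln n by rewrite ler_ln// posrE invr_gt0.
    by rewrite lnV ?posrE// mulr1; lra.
  have ln0 : ln n <= 0 by rewrite ln_le0.
  rewrite ln1 mulr0 sub0r.
  have [h|h] := boolP (r < n < r^-1); first by rewrite mulr0; lra.
  have h' : n <= r.
    move: h; case: ltP => //= rn; rewrite -leNgt => h.
    by have : 1 < r^-1 by [rewrite invf_gt1]; lra.
  have : ln n <= ln r by rewrite ler_ln.
  by rewrite mulr1; lra.
rewrite mulr_sumr big_seq.
apply: (le_trans (ler_sum _ pointwise)); rewrite -big_seq sumrB -mulr_sumr.
have lnprod (F : R[i] -> R) : (forall z, z \in zeros p -> 0 < F z) ->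
    \sum_(z <- zeros p) ln (F z) = ln (\prod_(z <- zeros p) F z).
  elim: (zeros p) => [|z s IHs] F0; first by rewrite !big_nil ln1.
  rewrite !big_cons lnM ?posrE ?F0 ?mem_head//; last first.
    rewrite big_seq; apply: prodr_gt0 => y ys; apply: F0.
    by rewrite inE ys orbT.
  by rewrite IHs// => y ys; apply: F0; rewrite inE ys orbT.
have zpos z : z \in zeros p -> 0 < cabs z.
  by move=> /(zeros_neq0 a00); rewrite cabs_gt0.
rewrite !lnprod//; last by move=> z _; rewrite lt_max ltr01.
have prod1 : 0 < \prod_(z <- zeros p) Num.max 1 (cabs z).
  by apply: prodr_gt0 => z _; rewrite lt_max ltr01.
have prod2 : 0 < \prod_(z <- zeros p) cabs z.
  by rewrite big_seq; apply: prodr_gt0 => z /zpos.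
have B0 : 0 < B by apply: lt_le_trans (mahler_measure_le pB); rewrite mulr_gt0.
have := mahler_measure_le pB.
rewrite -ler_ln ?posrE ?mulr_gt0// lnM ?posrE// => h.
rewrite cabsM cabs_coef0 !lnM ?posrE ?mulr_gt0//; lra.
Qed.

(** ** Discrepancy of the zeros in an annular sector *)

(** The logarithm of B / sqrt |a_0 a_n|, which is n times the quantity under the
    square root in the discrepancy bound. *)
Definition log_excess p B : R :=
  ln B - 2^-1 * ln (cabs (lead_coef p * p`_0)).

Lemma log_excess_ge0 p B : lead_coef p != 0 -> p`_0 != 0 ->
  (forall x, cabs p.[cis x] <= B) -> 0 <= log_excess p B.
Proof.
move=> an0 a00 pB.
have r01 : 0 < (2^-1 : R) < 1 by apply/andP; split; lra.
have := zeros_off_annulus r01 an0 a00 pB; rewrite -/(log_excess p B).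
set S := \sum_(_ <- _) _.
have : 0 <= S by apply: sumr_ge0 => z _; rewrite ler0n.
by lra.
Qed.

(** The sector contains all the zeros with argument in [a, b) except those off the
    annulus. The number of the latter is linear in X, hence of the order of sqrt X
    once X <= 1; for X >= 1 the bound exceeds 1. *)
Lemma annular_discrepancy p (n : nat) B r a b : size p = n.+1 -> (0 < n)%N ->
  p`_0 != 0 -> (forall x, cabs p.[cis x] <= B) ->
  0 < r < 1 -> 0 <= a -> a < b -> b < pi *+ 2 ->
  `|zero_counting_measure n p (annular_sector r a b) - (b - a) / (pi *+ 2)| <=
  discrepancy_const r * Num.sqrt (log_excess p B / n%:R).
Proof.
move=> sp n0 a00 pB r01 a0 ab b2.
have p0 : p != 0 by rewrite -size_poly_eq0 sp.
have an0 : lead_coef p != 0 by rewrite lead_coef_eq0.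
have sz : size (zeros p) = n by rewrite size_zeros// sp.
have n0' : 0 < n%:R :> R by rewrite ltr0n.
have /andP[r0 r1] := r01.
have pi0 := pi_gt0 R.
have H0 := log_excess_ge0 an0 a00 pB; set H := log_excess p B in H0 *.
set X := H / n%:R.
have X0 : 0 <= X by rewrite divr_ge0.
pose th := map principal_arg (zeros p).
have sth : size th = n by rewrite size_map.
have th01 x : x \in th -> 0 <= x < pi *+ 2.
  by move=> /mapP[z _ ->]; have [-> ->] := principal_argP z.
have ang := @angular_discrepancy th H a b.
rewrite sth in ang.
have {}ang := ang n0 H0 (schur_bound an0 a00 pB) th01 a0 (ltW ab) (ltW b2).
rewrite -/X in ang.
have out := zeros_off_annulus r01 an0 a00 pB; rewrite -/(log_excess p B) -/H in out.
have c_le := four_div_sqrt_pi_le R.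
rewrite /discrepancy_const; set c := Num.sqrt (pi *+ 2 / _) in c_le *.
set c0 := 4 / Num.sqrt pi in ang c_le.
have tauE : zero_counting_measure n p (annular_sector r a b) = n%:R^-1 *
    \sum_(z <- zeros p) (r < cabs z < r^-1)%R%:R * (a <= principal_arg z < b)%R%:R.
  rewrite /zero_counting_measure; congr (_ * _).
  rewrite big_seq [RHS]big_seq; apply: eq_bigr => z /(zeros_neq0 a00) z0.
  exact: annular_sectorE.
set tau := zero_counting_measure _ _ _ in tauE *.
set q := (b - a) / (pi *+ 2) in ang *.
rewrite big_map in ang.
set N1 := \sum_(z <- zeros p) (a <= principal_arg z < b)%R%:R in ang.
set N2 := \sum_(z <- zeros p) (~~ (r < cabs z < r^-1)%R)%:R in out.
set N3 := \sum_(z <- zeros p) _ in tauE.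
have N31 : N3 <= N1.
  apply: ler_sum => z _; rewrite -natrM ler_nat.
  by case: (_ < _ < _); rewrite ?mul0n ?mul1n.
have N132 : N1 <= N3 + N2.
  rewrite -big_split; apply: ler_sum => z _ /=; rewrite -natrM -natrD ler_nat.
  by case: (_ < _ < _); rewrite ?mul0n ?mul1n//= ?addn0// leq_b1.
have N30 : 0 <= N3 by apply: sumr_ge0 => z _; rewrite -natrM ler0n.
have N1n : N1 <= n%:R.
  rewrite -sz -[(size _)%:R]mulr1 -sum_const_seq; apply: ler_sum => z _.
  by rewrite -[1]/(1%:R) ler_nat leq_b1.
have q01 : 0 <= q <= 1.
  have pi2 : 0 < (pi : R) *+ 2 by rewrite mulrn_wgt0.
  apply/andP; split; first by apply: divr_ge0; [lra|exact: ltW].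
  by rewrite ler_pdivrMr// mul1r; lra.
have s0 := sqrtr_ge0 X; set s := Num.sqrt X in s0 ang *.
have sX : s ^+ 2 = X by rewrite sqr_sqrtr.
have r1' : 0 < 1 - r by lra.
have k2 : 2 <= 2 / (1 - r) by rewrite ler_pdivlMr//; lra.
have c0_ge0 : 0 <= c by exact: sqrtr_ge0.
have c00 : 0 <= c0 by rewrite divr_ge0// sqrtr_ge0.
have tauN : n%:R * tau = N3 by rewrite tauE mulrA divff ?mul1r ?gt_eqF.
have [s1|s1] := leP 1 s.
  have tau01 : 0 <= tau <= 1.
    rewrite -(pmulr_rge0 _ n0') tauN N30/= -(ler_pM2l n0') tauN mulr1.
    exact: le_trans N1n.
  apply: (@le_trans _ _ 1); first by rewrite ler_norml; apply/andP; split; lra.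
  by apply: mulr_ege1 => //; lra.
have N2_le : N2 <= n%:R * (2 / (1 - r) * s).
  have HX : H = n%:R * s ^+ 2 by rewrite sX /X mulrCA divff ?mulr1 ?gt_eqF.
  have s2 : s ^+ 2 <= s by rewrite expr2 ler_piMr// ltW.
  have -> : n%:R * (2 / (1 - r) * s) = 2 * (n%:R * s) / (1 - r).
    by field; rewrite lt0r_neq0.
  rewrite ler_pdivlMr// mulrC; apply: le_trans out _; rewrite HX.
  by rewrite ler_pM2l// ler_pM2l.
rewrite -(ler_pM2l n0') -{1}(ger0_norm (ltW n0')) -normrM mulrBr tauN.
have cs : n%:R * (c0 * s) <= n%:R * (c * s).
  by rewrite ler_pM2l// ler_wpM2r.
move: ang; rewrite !ler_norml => /andP[ang1 ang2].
have := mulr_ge0 (ltW n0') (mulr_ge0 (le_trans (ler0n _ 2) k2) s0).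
by move: (2 / (1 - r)) N2_le => k *; apply/andP; split; lra.
Qed.

End Discrepancy.
(** * Random variables and their logarithms *)

Section Measurability.
Context {d : measure_display} {T : measurableType d} {R : realType}.
Implicit Types (X Y : T -> R[i]).

Lemma complex_RV_parts X : complex_RV X <->
  measurable_fun setT (fun w => complex.Re (X w)) /\
  measurable_fun setT (fun w => complex.Im (X w)).
Proof.
split=> [mX|[mRe mIm]]; last exact: measurable_fun_pair.
split.
  exact: (measurableT_comp (@measurable_fst _ _ _ _) mX).
exact: (measurableT_comp (@measurable_snd _ _ _ _) mX).
Qed.

Lemma complex_RV_cst (c : R[i]) : complex_RV (fun _ : T => c).
Proof. by apply/complex_RV_parts; split; exact: measurable_cst. Qed.

Lemma complex_RV_add X Y : complex_RV X -> complex_RV Y ->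
  complex_RV (fun w => X w + Y w).
Proof.
move=> /complex_RV_parts[rX iX] /complex_RV_parts[rY iY].
apply/complex_RV_parts; split.
  have -> : (fun w => complex.Re (X w + Y w)) =
      (fun w => complex.Re (X w) + complex.Re (Y w)).
    by apply/funext => w; case: (X w) => ? ?; case: (Y w).
  exact: measurable_funD.
have -> : (fun w => complex.Im (X w + Y w)) =
    (fun w => complex.Im (X w) + complex.Im (Y w)).
  by apply/funext => w; case: (X w) => ? ?; case: (Y w).
exact: measurable_funD.
Qed.

Lemma complex_RV_mul X Y : complex_RV X -> complex_RV Y ->
  complex_RV (fun w => X w * Y w).
Proof.
move=> /complex_RV_parts[rX iX] /complex_RV_parts[rY iY].
apply/complex_RV_parts; split.
  have -> : (fun w => complex.Re (X w * Y w)) =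
      (fun w => complex.Re (X w) * complex.Re (Y w) -
                complex.Im (X w) * complex.Im (Y w)).
    by apply/funext => w; case: (X w) => ? ?; case: (Y w).
  by apply: measurable_funB; exact: measurable_funM.
have -> : (fun w => complex.Im (X w * Y w)) =
    (fun w => complex.Re (X w) * complex.Im (Y w) +
              complex.Im (X w) * complex.Re (Y w)).
  by apply/funext => w; case: (X w) => ? ?; case: (Y w).
by apply: measurable_funD; exact: measurable_funM.
Qed.

Lemma complex_RV_sum (I : Type) (s : seq I) (P : pred I) (F : I -> T -> R[i]) :
  (forall i, P i -> complex_RV (F i)) ->
  complex_RV (fun w => \sum_(i <- s | P i) F i w).
Proof.
move=> mF; elim: s => [|i s IHs].
  by under eq_fun do rewrite big_nil; exact: complex_RV_cst.
under eq_fun do rewrite big_cons.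
case: (boolP (P i)) => [Pi|//].
by apply: complex_RV_add => //; exact: mF.
Qed.

Lemma measurable_cabs X : complex_RV X -> measurable_fun setT (fun w => cabs (X w)).
Proof.
move=> /complex_RV_parts[rX iX].
have -> : (fun w => cabs (X w)) =
    (fun w => Num.sqrt (complex.Re (X w) ^+ 2 + complex.Im (X w) ^+ 2)).
  by apply/funext => w; case: (X w).
apply: (@measurableT_comp _ _ _ _ _ _ (@Num.sqrt R)).
  by apply: continuous_measurable_fun; exact: sqrt_continuous.
by apply: measurable_funD; exact: measurable_funX.
Qed.

Lemma measurable_log_cabs X : complex_RV X ->
  measurable_fun setT (fun w => lne (cabs (X w))%:E).
Proof.
move=> /measurable_cabs mX.
have -> : (fun w => lne (cabs (X w))%:E) =
    (fun w => if cabs (X w) <= 0 then -oo%E else (ln (cabs (X w)))%:E) by [].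
apply: measurable_fun_ifT.
- by apply: measurable_fun_ler => //; exact: measurable_cst.
- exact: measurable_cst.
- by apply/measurable_EFinP; exact: measurableT_comp.
Qed.

Lemma measurable_cabs_powR X t : complex_RV X ->
  measurable_fun setT (fun w => cabs (X w) `^ t).
Proof.
move=> /measurable_cabs mX.
exact: (measurableT_comp (@measurable_powR R t) mX). Qed.

End Measurability.

Lemma lne_cabsM (R : realType) (x y : R[i]) :
  lne (cabs (x * y))%:E = (lne (cabs x)%:E + lne (cabs y)%:E)%E.
Proof.
have [->|x0] := eqVneq x 0.
  by rewrite mul0r cabs0 /= lexx /=; case: ifP.
have [->|y0] := eqVneq y 0.
  by rewrite mulr0 cabs0 /= lexx /=; case: ifP.
rewrite cabsM !lne_EFin ?mulr_gt0 ?cabs_gt0//.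
by rewrite -EFinD lnM ?posrE ?cabs_gt0.
Qed.

(** The integral of a nonnegative function is the supremum of the integrals of the
    simple functions below it, measurable or not. So the discrepancy can be
    integrated without a study of how the zeros depend on the coefficients. *)
Lemma ge0_le_integral_nonmeasurable d (T : measurableType d) (R : realType)
    (mu : {measure set T -> \bar R}) (f g : T -> \bar R) :
  (forall x, (0 <= f x)%E) -> (forall x, (f x <= g x)%E) ->
  (\int[mu]_x f x <= \int[mu]_x g x)%E.
Proof.
move=> f0 fg; have g0 x : (0 <= g x)%E by exact: le_trans (fg x).
rewrite !ge0_integralE//; apply: ge_ereal_sup => _ [h /= hf <-].
apply: ereal_sup_ubound; exists h => //= x; apply: le_trans (hf x) _.
by rewrite !patch_setT.
Qed.

Section Integrability.
Context {d : measure_display} {T : measurableType d} {R : realType}.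
Variable P : probability T R.
Local Open Scope ereal_scope.

Lemma integral_probability_cst (c : R) : \int[P]_w c%:E = c%:E.
Proof. by rewrite integral_cst//= probability_setT mule1. Qed.

Lemma ge0_integral_add_cst (f : T -> \bar R) (c : R) : (forall w, 0 <= f w) ->
  measurable_fun setT f -> (0 <= c)%R ->
  \int[P]_w (f w + c%:E) = \int[P]_w f w + c%:E.
Proof.
move=> f0 mf c0; rewrite -[in RHS](integral_probability_cst c).
by apply: ge0_integralD => //.
Qed.

(** As oo - oo is -oo by convention, an integral above -oo has a finite negative
    part. *)
Lemma integrable_of_integral_gt (f : T -> \bar R) : measurable_fun setT f ->
  \int[P]_w f^\+ w < +oo -> -oo < \int[P]_w f w -> P.-integrable setT f.
Proof.
move=> mf fp fi; apply/integrableP; split=> //.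
have fn : \int[P]_w f^\- w < +oo.
  rewrite ltey; apply: contraTneq fi => e.
  by rewrite integralE e /= addeNy.
rewrite -[X in \int[P]_x X x]/(abse \o f) fune_abse.
rewrite ge0_integralD//; [exact: lte_add_pinfty|
  exact: measurable_funepos|exact: measurable_funeneg].
Qed.

Lemma integral_funepos_lt (f : T -> \bar R) (u : T -> R) :
  measurable_fun setT f -> P.-integrable setT (EFin \o u) ->
  (forall w, f w <= (u w)%:E) -> \int[P]_w f^\+ w < +oo.
Proof.
move=> mf iu fu; have /integrableP[mu uoo] := iu.
apply: le_lt_trans uoo; apply: ge0_le_integral => //.
- exact: measurable_funepos.
- exact: measurableT_comp.
move=> w _; rewrite funeposE ge_max abse_ge0 andbT.
by apply: le_trans (fu w) _; rewrite lee_fin ler_norm.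
Qed.

End Integrability.
(** * The expected discrepancy *)

Section RandomPolynomial.
Variable R : realType.
Implicit Types (p : {poly R[i]}) (b : nat -> nat -> R[i]).

Lemma sup_norm_ge p (x : R) : cabs p.[cis x] <= sup_norm p.
Proof.
rewrite /sup_norm; apply: ub_le_sup; last by exists (cis x) => //; exact: cabs_cis.
exists (\sum_(i < size p) cabs p`_i) => _ [z /= z1 <-].
rewrite horner_coef; apply: le_trans (cabs_sum_le _ _) _.
by apply: ler_sum => i _; rewrite cabsM cabsX z1 expr1n mulr1.
Qed.

Lemma coef_le_sup_norm p j : cabs p`_j <= sup_norm p.
Proof. by apply: coef_le_circle => x; exact: sup_norm_ge. Qed.

Definition max_sup_norm b n : R :=
  \big[Num.max/0]_(k < n.+1) sup_norm (basis_poly b k).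

Lemma sup_norm_le_max b n (k : 'I_n.+1) :
  sup_norm (basis_poly b k) <= max_sup_norm b n.
Proof. exact: (le_bigmax_cond _ (fun k : 'I_n.+1 => sup_norm (basis_poly b k))). Qed.

Lemma coef_le_max_sup_norm b n j k : (j <= k)%N -> (k <= n)%N ->
  cabs (b j k) <= max_sup_norm b n.
Proof.
move=> jk kn; apply: le_trans (sup_norm_le_max b (Ordinal (kn : (k < n.+1)%N))).
have := coef_le_sup_norm (basis_poly b k) j.
by rewrite coef_poly ltnS jk.
Qed.

Section Coefficients.
Context {d : measure_display} {T : measurableType d}.
Variables (b : nat -> nat -> R[i]) (A : nat -> T -> R[i]) (n : nat) (w : T).
Let p := random_poly b A n w.

Lemma coef_random_poly j : p`_j =
  \sum_(k < n.+1) A k w * (if (j <= k)%N then b j k else 0).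
Proof.
by rewrite coef_sum; apply: eq_bigr => k _; rewrite coefZ coef_poly ltnS.
Qed.

Lemma coef0_random_poly : p`_0 = \sum_(k < n.+1) A k w * b 0%N k.
Proof. exact: coef_random_poly. Qed.

Lemma coefn_random_poly : p`_n = A n w * b n n.
Proof.
rewrite coef_random_poly big_ord_recr/= leqnn big1 ?add0r// => k _.
by rewrite leqNgt ltn_ord/= mulr0.
Qed.

Lemma size_random_poly : A n w * b n n != 0 -> size p = n.+1.
Proof.
move=> h; apply/eqP; rewrite eqn_leq; apply/andP; split; last first.
  by apply: contraNltn h => sn; rewrite -coefn_random_poly nth_default.
apply: (leq_trans (size_sum _ _ _)); apply/bigmax_leqP => k _.
apply: (leq_trans (size_scale_leq _ _)); apply: (leq_trans (size_poly _ _)).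
exact: ltn_ord.
Qed.

Lemma end_coefsE : A n w * b n n != 0 -> end_coefs b A n w = lead_coef p * p`_0.
Proof.
move=> h; rewrite /end_coefs -coef0_random_poly -coefn_random_poly.
by rewrite lead_coefE size_random_poly.
Qed.

Lemma random_poly_circle (x : R) :
  cabs p.[cis x] <= max_sup_norm b n * \sum_(k < n.+1) cabs (A k w).
Proof.
rewrite horner_sum; apply: le_trans (cabs_sum_le _ _) _.
rewrite mulr_sumr; apply: ler_sum => k _; rewrite hornerZ cabsM mulrC.
apply: ler_wpM2r; first exact: cabs_ge0.
exact: le_trans (sup_norm_ge _ _) (sup_norm_le_max _ _).
Qed.

End Coefficients.

(** Each ratio x_i / sum x lies in [0, 1], where u <= u ^ t. *)
Lemma powR_sum_le (I : finType) (x : I -> R) t : 0 < t <= 1 ->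
  (forall i, 0 <= x i) -> (\sum_i x i) `^ t <= \sum_i x i `^ t.
Proof.
move=> /andP[t0 t1] x0; set S := \sum_i x i.
have S0 : 0 <= S by exact: sumr_ge0.
have [->|Sn0] := eqVneq S 0.
  by rewrite powR0 ?gt_eqF// sumr_ge0// => i _; exact: powR_ge0.
have Sgt : 0 < S by rewrite lt_neqAle eq_sym Sn0.
have -> : S `^ t = \sum_i x i / S * S `^ t.
  by rewrite -mulr_suml -mulr_suml -/S divff// mul1r.
apply: ler_sum => i _.
have {2}-> : x i = x i / S * S by rewrite divfK.
rewrite powRM ?divr_ge0//; apply: ler_wpM2r; first exact: powR_ge0.
have [->|xi] := eqVneq (x i) 0; first by rewrite mul0r powR0 ?gt_eqF.
have y0 : 0 < x i / S by rewrite divr_gt0// lt_neqAle eq_sym xi x0.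
rewrite -[leLHS](powRr1 (ltW y0)); apply: ger_powR => //.
rewrite y0/= ler_pdivrMr// mul1r /S (bigD1 i)//= lerDl.
by apply: sumr_ge0 => j _.
Qed.

Lemma ln_le_tangent (x y : R) : 0 < x -> 0 < y -> ln x <= x / y - 1 + ln y.
Proof.
move=> x0 y0; have xy : 0 < x / y by rewrite divr_gt0.
have /le_ln1Dx : -1 < x / y - 1 by lra.
by rewrite subrKC lnM ?posrE ?invr_gt0// lnV ?posrE//; lra.
Qed.

(** Each x_i is at most exp (x_i ^ t / t). This crude bound is valid for every t > 0
    and suffices for integrability. *)
Lemma sum_le_exp n (x : 'I_n -> R) t : 0 < t -> (forall i, 0 <= x i) ->
  \sum_i x i <= n%:R * expR ((\sum_i x i `^ t) / t).
Proof.
move=> t0 x0; rewrite mulr_natl -[X in _ *+ X]card_ord -sumr_const.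
apply: ler_sum => i _; set V := \sum_i _.
have [->|xi] := eqVneq (x i) 0; first exact: expR_ge0.
have xgt : 0 < x i by rewrite lt_neqAle eq_sym xi x0.
rewrite -[leLHS]lnK ?posrE// ler_expR ler_pdivlMr// mulrC -ln_powR.
have pw : 0 < x i `^ t by exact: powR_gt0.
apply: le_trans (ltW (ln_sublinear pw)) _.
rewrite /V (bigD1 i)//= lerDl; apply: sumr_ge0 => j _; exact: powR_ge0.
Qed.

Lemma lne_le (y u : R) : y <= expR u -> (lne y%:E <= u%:E)%E.
Proof.
move=> yu; rewrite /lne; case: ifPn => y0; first by rewrite leNye.
rewrite -ltNge in y0.
by rewrite lee_fin -(expRK u) ler_ln// posrE expR_gt0.
Qed.

End RandomPolynomial.

Section ExpectedDiscrepancy.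
Context {d : measure_display} {T : measurableType d} {R : realType}.
Variables (P : probability T R) (b : nat -> nat -> R[i]) (A : nat -> T -> R[i]).
Variables (n : nat) (t : R).
Hypothesis b_neq0 : forall k, b k k != 0.
Hypothesis t_gt0 : 0 < t.
Hypothesis A_RV : forall k, (k <= n)%N -> complex_RV (A k).
Hypothesis A_moment : forall k, (k <= n)%N ->
  ('E_P[fun w => (cabs (A k w) `^ t)%R] < +oo)%E.

Let M := max_sup_norm b n.

Lemma max_sup_norm_gt0 : 0 < M.
Proof.
apply: lt_le_trans (coef_le_max_sup_norm b (leqnn n) (leqnn n)).
by rewrite cabs_gt0.
Qed.

Definition abs_sum (w : T) : R := \sum_(k < n.+1) cabs (A k w).
Definition moment_sum (w : T) : R := \sum_(k < n.+1) cabs (A k w) `^ t.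

Lemma moment_sum_ge0 w : 0 <= moment_sum w.
Proof. by apply: sumr_ge0 => k _; exact: powR_ge0. Qed.

Lemma integrable_moment k : (k <= n)%N ->
  P.-integrable setT (EFin \o (fun w => cabs (A k w) `^ t)).
Proof.
move=> kn; apply/integrableP; split.
  by apply/measurable_EFinP; apply: measurable_cabs_powR; exact: A_RV.
have := A_moment kn; rewrite unlock; apply: le_lt_trans.
by under eq_integral do rewrite /= ger0_norm ?powR_ge0//.
Qed.

Lemma integrable_moment_sum : P.-integrable setT (EFin \o moment_sum).
Proof.
have -> : EFin \o moment_sum =
    (fun w => \sum_(k < n.+1) (cabs (A k w) `^ t)%:E)%E.
  by apply/funext => w; rewrite /= sumEFin.
apply: integrable_sum => // k _; exact: (integrable_moment (ltn_ord k)).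
Qed.

Lemma integral_moment_sum : (\int[P]_w (moment_sum w)%:E =
  \sum_(k < n.+1) 'E_P[fun w => (cabs (A k w) `^ t)%R])%E.
Proof.
under eq_integral do rewrite -sumEFin.
rewrite ge0_integral_sum//.
- by apply: eq_bigr => k _; rewrite unlock.
- move=> k; apply/measurable_EFinP; apply: measurable_cabs_powR.
  exact: (A_RV (ltn_ord k)).
- by move=> k w _; rewrite lee_fin powR_ge0.
Qed.

Lemma complex_RV_end_coefs : complex_RV (end_coefs b A n).
Proof.
apply: complex_RV_mul.
  by apply: complex_RV_mul; [exact: A_RV|exact: complex_RV_cst].
apply: complex_RV_sum => k _.
by apply: complex_RV_mul; [exact: (A_RV (ltn_ord k))|exact: complex_RV_cst].
Qed.

(** The A_k have a moment of some positive order t, and log grows more slowly than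
    u ^ t, so sum |A_k| ^ t / t plus a constant is an integrable majorant. *)
Lemma log_funepos_lt (X : T -> R[i]) (c : R) : complex_RV X -> 0 < c ->
  (forall w, cabs (X w) <= c * abs_sum w) ->
  (\int[P]_w (fun w => lne (cabs (X w))%:E)^\+ w < +oo)%E.
Proof.
move=> mX c0 Xc.
pose u w := moment_sum w / t + ln (c * n.+1%:R).
apply: (@integral_funepos_lt _ _ _ P _ u); first exact: measurable_log_cabs.
  have -> : EFin \o u =
      ((fun w => (t^-1)%:E * (moment_sum w)%:E) \+ cst (ln (c * n.+1%:R))%:E)%E.
    by apply/funext => w; rewrite /u /= -EFinM -EFinD mulrC.
  apply: integrableD => //; last first.
    by apply: finite_measure_integrable_cst.
  by apply: integrableZl => //; exact: integrable_moment_sum.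
move=> w; apply: lne_le; apply: le_trans (Xc w) _.
rewrite /u expRD lnK ?posrE ?mulr_gt0// [leRHS]mulrC -mulrA ler_pM2l//.
by apply: sum_le_exp => // k; exact: cabs_ge0.
Qed.

Hypothesis n_gt0 : (0 < n)%N.
Hypothesis t_le1 : t <= 1.
Hypothesis log_end : (-oo < expect_log P (end_coefs b A n))%E.

(** A linear majorant of log (M sum |A_k|), tangent at the value y of
    sum |A_k| ^ t: it plays the part of Jensen's inequality for the logarithm. *)
Definition log_majorant (y : R) (w : T) : R :=
  t^-1 * (moment_sum w / y - 1 + ln y) + ln M.

Lemma ln_abs_sum_le y w : 0 < y -> 0 < abs_sum w ->
  ln (M * abs_sum w) <= log_majorant y w.
Proof.
move=> y0 S0; rewrite lnM ?posrE ?max_sup_norm_gt0// addrC lerD2r.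
have St : 0 < abs_sum w `^ t by exact: powR_gt0.
have le : abs_sum w `^ t <= moment_sum w.
  by apply: powR_sum_le => [|k]; [rewrite t_gt0|exact: cabs_ge0].
have V0 : 0 < moment_sum w by exact: lt_le_trans le.
rewrite ler_pdivlMl// -ln_powR; apply: le_trans (ln_le_tangent V0 y0).
by rewrite ler_ln.
Qed.

Lemma end_coefs_neq0 w : end_coefs b A n w != 0 ->
  let p := random_poly b A n w in
  [/\ size p = n.+1, lead_coef p != 0, p`_0 != 0 & 0 < abs_sum w].
Proof.
move=> D0 /=.
have /andP[h1 h2] : (A n w * b n n != 0) &&
    (\sum_(k < n.+1) A k w * b 0%N k != 0).
  by move: D0; rewrite /end_coefs mulf_eq0 negb_or.
have sz := size_random_poly h1; split => //.
- by rewrite lead_coef_eq0 -size_poly_eq0 sz.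
- by rewrite coef0_random_poly.
- rewrite /abs_sum big_ord_recr/=; apply: ltr_wpDl.
    by apply: sumr_ge0 => k _; exact: cabs_ge0.
  by rewrite cabs_gt0; apply: contraNneq h1 => ->; rewrite mul0r.
Qed.

Lemma log_excess_le y w : 0 < y -> end_coefs b A n w != 0 ->
  0 <= log_excess (random_poly b A n w) (M * abs_sum w) <=
  log_majorant y w - 2^-1 * ln (cabs (end_coefs b A n w)).
Proof.
move=> y0 D0; have [sz l0 c0 S0] := end_coefs_neq0 D0.
rewrite log_excess_ge0//; last by move=> x; exact: random_poly_circle.
rewrite /log_excess end_coefsE ?lerD2r ?ln_abs_sum_le//.
by move: D0; rewrite /end_coefs mulf_eq0 negb_or => /andP[].
Qed.

Let D_log w : \bar R := lne (cabs (end_coefs b A n w))%:E.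

(** n times the majorant of the quantity under the square root; it is +oo when D_n
    vanishes. *)
Definition excess_majorant (y : R) (w : T) : \bar R :=
  ((log_majorant y w)%:E + (- 2^-1)%:E * D_log w)%E.

Lemma excess_majorantE y w : end_coefs b A n w != 0 -> excess_majorant y w =
  (log_majorant y w - 2^-1 * ln (cabs (end_coefs b A n w)))%:E.
Proof.
move=> D0; rewrite /excess_majorant /D_log lne_EFin ?cabs_gt0//.
by rewrite -EFinM -EFinD mulNr.
Qed.

Lemma excess_majorant0 y w : end_coefs b A n w = 0 -> excess_majorant y w = +oo%E.
Proof.
move=> D0; rewrite /excess_majorant /D_log D0 cabs0 le0_lneNy//.
by rewrite EFinN mulNe gt0_muleNy ?lte_fin// oppeNy addeC.
Qed.

(** For every s > 0, sqrt x <= (x / s + s) / 2, with equality at x = s ^ 2. *)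
Lemma discrepancy_le_majorant y s r alpha beta w : 0 < y -> 0 < s ->
  0 < r < 1 -> 0 <= alpha -> alpha < beta -> beta < pi *+ 2 ->
  ((`|zero_counting_measure n (random_poly b A n w)
       (annular_sector r alpha beta) - (beta - alpha) / (pi *+ 2)|)%:E <=
   (discrepancy_const r / (2 * s * n%:R))%:E * excess_majorant y w +
   (discrepancy_const r * s / 2)%:E)%E.
Proof.
move=> y0 s0 r01 a0 ab b2.
have n0 : 0 < n%:R :> R by rewrite ltr0n.
have C0 : 0 < discrepancy_const r.
  rewrite ltr_wpDl ?sqrtr_ge0// divr_gt0// subr_gt0.
  by case/andP: r01.
have k0 : 0 < discrepancy_const r / (2 * s * n%:R) by rewrite divr_gt0 ?mulr_gt0.
have [D0|D0] := eqVneq (end_coefs b A n w) 0.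
  by rewrite excess_majorant0// gt0_muley ?lte_fin// addye// leey.
have [sz l0 c0 S0] := end_coefs_neq0 D0.
have := annular_discrepancy sz n_gt0 c0 (random_poly_circle b A n w) r01 a0 ab b2.
have /andP[] := log_excess_le y0 D0.
rewrite excess_majorantE// -/M -/(abs_sum w).
move: (log_excess _ _) (_ - 2^-1 * _) => X Y X0 XY h.
rewrite -EFinM -EFinD lee_fin; apply: le_trans h _.
set c := discrepancy_const r in C0 k0 *.
have -> : c / (2 * s * n%:R) * Y + c * s / 2 = c * ((Y / n%:R / s + s) / 2).
  by field; rewrite !lt0r_neq0.
rewrite ler_pM2l//.
have q0 : 0 <= X / n%:R by rewrite divr_ge0// ltW.
have qY : X / n%:R <= Y / n%:R by rewrite ler_pM2r// invr_gt0.
rewrite ler_pdivlMr// -(ler_pM2r s0) mulrDl divfK ?lt0r_neq0//.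
have := sqr_sqrtr q0; move: (Num.sqrt _) => x xE.
by have := sqr_ge0 (x - s); rewrite sqrrB xE; lra.
Qed.

Let integrable_D_log : P.-integrable setT D_log.
Proof.
apply: integrable_of_integral_gt => //.
  by apply: measurable_log_cabs; exact: complex_RV_end_coefs.
have mlog : measurable_fun setT D_log.
  by apply: measurable_log_cabs; exact: complex_RV_end_coefs.
have imaj : P.-integrable setT (EFin \o (fun w => 2 * log_majorant 1 w)).
  have -> : EFin \o (fun w => 2 * log_majorant 1 w) =
      ((fun w => (2 * t^-1)%:E * (moment_sum w)%:E) \+
       cst (2 * (ln M - t^-1))%:E)%E.
    apply/funext => w; rewrite /= -EFinM -EFinD /log_majorant ln1 divr1.
    by congr (_%:E); ring.
  apply: integrableD => //; last exact: finite_measure_integrable_cst.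
  by apply: integrableZl => //; exact: integrable_moment_sum.
apply: (integral_funepos_lt mlog imaj) => w.
have [D0|D0] := eqVneq (end_coefs b A n w) 0.
  by rewrite /D_log D0 cabs0 le0_lneNy// leNye.
have /andP[x0 xy] := log_excess_le ltr01 D0.
rewrite /D_log lne_EFin ?cabs_gt0// lee_fin.
by have := le_trans x0 xy; lra.
Qed.

Let E_moment : R := fine (\int[P]_w (moment_sum w)%:E)%E.
Let E_log : R := fine (expect_log P (end_coefs b A n)).

Let E_momentE : (\int[P]_w (moment_sum w)%:E = E_moment%:E)%E.
Proof.
by rewrite fineK//; apply: integrable_fin_num => //; exact: integrable_moment_sum.
Qed.

Let E_logE : expect_log P (end_coefs b A n) = E_log%:E.
Proof. by rewrite fineK//; exact: integrable_fin_num. Qed.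

Lemma log_majorantE y : EFin \o log_majorant y =
  ((fun w => (t^-1 * y^-1)%:E * (moment_sum w)%:E) \+
   cst (t^-1 * (ln y - 1) + ln M)%:E)%E.
Proof.
apply/funext => w; rewrite /= -EFinM -EFinD /log_majorant.
by congr (_%:E); ring.
Qed.

Lemma integrable_excess_majorant y : P.-integrable setT (excess_majorant y).
Proof.
apply: integrableD => //; last exact: integrableZl.
rewrite -/(EFin \o log_majorant y) log_majorantE.
apply: integrableD => //; last exact: finite_measure_integrable_cst.
by apply: integrableZl => //; exact: integrable_moment_sum.
Qed.

Lemma integral_excess_majorant y : (\int[P]_w excess_majorant y w =
  (t^-1 * (E_moment / y - 1 + ln y) + ln M - 2^-1 * E_log)%:E)%E.
Proof.
have im := integrable_moment_sum.
have il : P.-integrable setT (EFin \o log_majorant y).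
  rewrite log_majorantE.
  by apply: integrableD => //; [exact: integrableZl|exact: finite_measure_integrable_cst].
rewrite integralD//; [|exact: integrableZl].
rewrite integralZl// -[X in (_ + _ * X)%E]/(expect_log P (end_coefs b A n)) E_logE.
have -> : (\int[P]_w (log_majorant y w)%:E =
    (t^-1 * (E_moment / y - 1 + ln y) + ln M)%:E)%E.
  rewrite -[LHS]/(integral P setT (EFin \o log_majorant y)) log_majorantE.
  rewrite integralD//; [|exact: integrableZl|exact: finite_measure_integrable_cst].
  rewrite integralZl// E_momentE integral_probability_cst -EFinM -EFinD.
  by congr (_%:E); ring.
by rewrite -EFinM -EFinD mulNr.
Qed.

Lemma excess_majorant_ge0 y w : 0 < y -> (0 <= excess_majorant y w)%E.
Proof.
move=> y0; have [D0|D0] := eqVneq (end_coefs b A n w) 0.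
  by rewrite excess_majorant0.
have /andP[x0 xy] := log_excess_le y0 D0.
by rewrite excess_majorantE// lee_fin; exact: le_trans xy.
Qed.

Lemma integral_excess_majorant_ge0 y : 0 < y ->
  0 <= t^-1 * (E_moment / y - 1 + ln y) + ln M - 2^-1 * E_log.
Proof.
move=> y0; rewrite -lee_fin -integral_excess_majorant.
by apply: integral_ge0 => w _; exact: excess_majorant_ge0.
Qed.

(** The expected majorant is nonnegative for every y > 0, but if the moments vanished
    it would tend to -oo as y tends to 0. *)
Lemma E_moment_gt0 : 0 < E_moment.
Proof.
rewrite lt_neqAle eq_sym; apply/andP; split; last first.
  rewrite -lee_fin -E_momentE; apply: integral_ge0 => w _.
  by rewrite lee_fin moment_sum_ge0.
apply/eqP => E0.
have h z : 0 <= t^-1 * (z - 1) + ln M - 2^-1 * E_log.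
  have := integral_excess_majorant_ge0 (expR_gt0 z).
  by rewrite E0 mul0r add0r expRK addrC [_ + z]addrC; lra.
have := h (1 + t * (2^-1 * E_log - ln M - 1)).
by rewrite [1 + _]addrC addrK mulrA mulVf ?gt_eqF// mul1r; lra.
Qed.

(** Integrate [discrepancy_le_majorant] with the tangent points at the means: y is the
    expected moment sum, and s is slightly above the square root of the expected
    majorant, in case that root is 0. *)
Lemma expected_discrepancy_le r alpha beta :
  0 < r < 1 -> 0 <= alpha -> alpha < beta -> beta < pi *+ 2 ->
  (expected_discrepancy P b A n r alpha beta <= discrepancy_bound P b A n t r)%E.
Proof.
move=> r01 a0 ab b2; have E0 := E_moment_gt0.
have n0 : 0 < n%:R :> R by rewrite ltr0n.
have C0 : 0 < discrepancy_const r.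
  rewrite ltr_wpDl ?sqrtr_ge0// divr_gt0// subr_gt0.
  by case/andP: r01.
pose Y := n%:R^-1 * (t^-1 * ln E_moment + ln M - 2^-1 * E_log).
have intY : (\int[P]_w excess_majorant E_moment w = (n%:R * Y)%:E)%E.
  rewrite integral_excess_majorant divff ?gt_eqF// subrr add0r.
  by rewrite /Y mulrA divff ?gt_eqF// mul1r.
have Y0 : 0 <= Y.
  rewrite -(pmulr_rge0 _ n0) -lee_fin -intY.
  by apply: integral_ge0 => w _; exact: excess_majorant_ge0.
have -> : discrepancy_bound P b A n t r = (discrepancy_const r * Num.sqrt Y)%:E.
  by rewrite /discrepancy_bound -integral_moment_sum E_momentE lne_EFin// E_logE.
apply/lee_addgt0Pr => e e0.
set c := discrepancy_const r in C0 *.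
pose s := Num.sqrt Y + e / c.
have s0 : 0 < s by rewrite ltr_wpDl ?sqrtr_ge0// divr_gt0.
have k0 : 0 < c / (2 * s * n%:R) by rewrite divr_gt0 ?mulr_gt0.
rewrite /expected_discrepancy unlock.
apply: (@le_trans _ _ (\int[P]_w ((c / (2 * s * n%:R))%:E *
    excess_majorant E_moment w + (c * s / 2)%:E))%E).
  apply: ge0_le_integral_nonmeasurable => w; first by rewrite lee_fin.
  exact: discrepancy_le_majorant.
have ie := integrable_excess_majorant E_moment.
rewrite integralD//; [|exact: integrableZl|exact: finite_measure_integrable_cst].
rewrite integralZl// intY integral_probability_cst -EFinM -!EFinD lee_fin.
have -> : c / (2 * s * n%:R) * (n%:R * Y) = c / 2 * (Y / s).
  by field; rewrite !lt0r_neq0.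
have q_le : Y / s <= Num.sqrt Y.
  rewrite ler_pdivrMr// -{1}(sqr_sqrtr Y0) expr2 ler_wpM2l ?sqrtr_ge0//.
  by rewrite lerDl ltW// divr_gt0.
have ce : c * (e / c) = e by rewrite mulrC divfK// gt_eqF.
have h1 := ler_wpM2l (ltW C0) q_le; have h2 : c * s = c * Num.sqrt Y + e.
  by rewrite /s mulrDr ce.
by move: h1 h2; move: (Y / s) (Num.sqrt Y) => q x h1 h2; lra.
Qed.

End ExpectedDiscrepancy.
(** * Independence *)

Section IndependentPair.
Context {d d1 d2 : measure_display} {T : measurableType d} {R : realType}.
Context {S1 : measurableType d1} {S2 : measurableType d2}.
Variables (P : probability T R) (X : {mfun T >-> S1}) (Y : {mfun T >-> S2}).
Hypothesis XY_indep : forall U V, measurable U -> measurable V ->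
  (P (X @^-1` U `&` Y @^-1` V) = P (X @^-1` U) * P (Y @^-1` V))%E.
Variable f : S1 * S2 -> \bar R.
Hypothesis mf : measurable_fun setT f.
Hypothesis f0 : forall q, (0 <= f q)%E.

Let measurable_pair : measurable_fun setT (fun w => (X w, Y w)).
Proof. by apply: measurable_fun_pair; exact: measurable_funPT. Qed.

Let XY : {mfun T >-> (S1 * S2)%type} :=
  HB.pack (fun w => (X w, Y w))
    (isMeasurableFun.Build _ _ _ _ (fun w => (X w, Y w)) measurable_pair).

Lemma measurable_integral_section :
  measurable_fun setT (fun w => \int[P]_v f (X v, Y w))%E.
Proof.
have -> : (fun w => \int[P]_v f (X v, Y w))%E =
    fubini_G (distribution P X) f \o Y.
  apply/funext => w; rewrite /fubini_G/= ge0_integral_distribution//.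
  exact: measurable_fun_pair1.
apply: measurableT_comp; last exact: measurable_funPT.
exact: measurable_fun_fubini_tonelli_G.
Qed.

(** Tonelli for the joint law, which is the product of the marginal laws. *)
Lemma ge0_integral_independent :
  (\int[P]_w f (X w, Y w) = \int[P]_w \int[P]_v f (X v, Y w))%E.
Proof.
have -> : (\int[P]_w f (X w, Y w) = \int[distribution P XY]_q f q)%E.
  by rewrite ge0_integral_distribution.
have -> : (\int[distribution P XY]_q f q =
    \int[distribution P X \x distribution P Y]_q f q)%E.
  apply: eq_measure_integral => /= C mC _; apply/esym.
  exact: (@product_measure_unique _ _ _ _ _ (distribution P X)
    (distribution P Y) (distribution P XY)).
rewrite fubini_tonelli2// ge0_integral_distribution//.
- apply: eq_integral => w _; rewrite /fubini_G/= ge0_integral_distribution//.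
  exact: measurable_fun_pair1.
- exact: measurable_fun_fubini_tonelli_G.
- by move=> y; apply: integral_ge0.
Qed.

End IndependentPair.

Section LogOfSum.
Context {d : measure_display} {T : measurableType d} {R : realType}.
Variables (P : probability T R).
Implicit Types X Z : T -> R[i].
Local Notation C2 := (measurableTypeR R * measurableTypeR R)%type.

Let add_pair (q : C2 * C2) : R[i] :=
  (q.1.1 + q.2.1) +i* (q.1.2 + q.2.2).

Let add_pairE (x z : R[i]) : add_pair (complex_pair x, complex_pair z) = x + z.
Proof. by case: x => ? ?; case: z. Qed.

Let measurable_add_pair : complex_RV add_pair.
Proof.
apply/complex_RV_parts; split.
  have -> : (fun q => complex.Re (add_pair q)) = (fun q : C2 * C2 => q.1.1 + q.2.1).
    by [].
  apply: measurable_funD.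
    exact: (measurableT_comp (@measurable_fst _ _ _ _) (@measurable_fst _ _ _ _)).
  exact: (measurableT_comp (@measurable_fst _ _ _ _) (@measurable_snd _ _ _ _)).
have -> : (fun q => complex.Im (add_pair q)) = (fun q : C2 * C2 => q.1.2 + q.2.2).
  by [].
apply: measurable_funD.
  exact: (measurableT_comp (@measurable_snd _ _ _ _) (@measurable_fst _ _ _ _)).
exact: (measurableT_comp (@measurable_snd _ _ _ _) (@measurable_snd _ _ _ _)).
Qed.

Local Open Scope ereal_scope.

(** Condition on Z. The positive part of the logarithm is integrable, so the bound
    on the conditional expectation bounds the negative part, and Tonelli applies to
    each part. *)
Lemma expect_log_add_ge X Z (L : R) : complex_RV X -> complex_RV Z ->
  (forall U V : set C2, measurable U -> measurable V ->
    P ((complex_pair \o X) @^-1` U `&` (complex_pair \o Z) @^-1` V) =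
    P ((complex_pair \o X) @^-1` U) * P ((complex_pair \o Z) @^-1` V)) ->
  (forall z : R[i], L%:E <= expect_log P (fun w => X w + z)%R) ->
  \int[P]_w (fun w => lne (cabs (X w + Z w)%R)%:E)^\+ w < +oo ->
  L%:E <= expect_log P (fun w => X w + Z w)%R.
Proof.
move=> mX mZ XZ hL pos.
pose Xp : {mfun T >-> C2} := HB.pack (complex_pair \o X)
  (isMeasurableFun.Build _ _ _ _ (complex_pair \o X) mX).
pose Zp : {mfun T >-> C2} := HB.pack (complex_pair \o Z)
  (isMeasurableFun.Build _ _ _ _ (complex_pair \o Z) mZ).
have {}XZ : forall U V, measurable U -> measurable V ->
    P (Xp @^-1` U `&` Zp @^-1` V) = P (Xp @^-1` U) * P (Zp @^-1` V) by exact: XZ.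
pose g (q : C2 * C2) : \bar R := lne (cabs (add_pair q))%:E.
have mg : measurable_fun setT g by exact: measurable_log_cabs.
have mgp := measurable_funepos mg; have mgn := measurable_funeneg mg.
have gE v w : g (Xp v, Zp w) = lne (cabs (X v + Z w)%R)%:E.
  by rewrite -add_pairE.
pose logw w v := lne (cabs (X v + Z w)%R)%:E.
have posE : \int[P]_w (fun w => lne (cabs (X w + Z w)%R)%:E)^\+ w =
    \int[P]_w \int[P]_v (logw w)^\+ v.
  transitivity (\int[P]_w g^\+ (Xp w, Zp w)).
    by apply: eq_integral => w _; rewrite !funeposE gE.
  rewrite (ge0_integral_independent XZ mgp (funepos_ge0 g)); apply: eq_integral => w _.
  by apply: eq_integral => v _; rewrite !funeposE gE.
have negE : \int[P]_w (fun w => lne (cabs (X w + Z w)%R)%:E)^\- w =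
    \int[P]_w \int[P]_v (logw w)^\- v.
  transitivity (\int[P]_w g^\- (Xp w, Zp w)).
    by apply: eq_integral => w _; rewrite !funenegE gE.
  rewrite (ge0_integral_independent XZ mgn (funeneg_ge0 g)); apply: eq_integral => w _.
  by apply: eq_integral => v _; rewrite !funenegE gE.
have mpos : measurable_fun setT (fun w => \int[P]_v (logw w)^\+ v).
  have -> : (fun w => \int[P]_v (logw w)^\+ v) =
      (fun w => \int[P]_v g^\+ (Xp v, Zp w)).
    by apply/funext => w; apply: eq_integral => v _; rewrite !funeposE gE.
  exact: measurable_integral_section.
have mneg : measurable_fun setT (fun w => \int[P]_v (logw w)^\- v).
  have -> : (fun w => \int[P]_v (logw w)^\- v) =
      (fun w => \int[P]_v g^\- (Xp v, Zp w)).
    by apply/funext => w; apply: eq_integral => v _; rewrite !funenegE gE.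
  exact: measurable_integral_section.
have Lp0 : (0 <= Num.max L 0)%R by rewrite le_max lexx orbT.
have Ln0 : (0 <= Num.max (- L) 0)%R by rewrite le_max lexx orbT.
have LE : L = (Num.max L 0 - Num.max (- L) 0)%R.
  by case: (leP L 0%R); case: (leP (- L)%R 0%R); lra.
have cond w : \int[P]_v (logw w)^\- v + (Num.max L 0)%:E <=
    \int[P]_v (logw w)^\+ v + (Num.max (- L) 0)%:E.
  have := hL (Z w); rewrite /expect_log integralE -/(logw w).
  have : 0 <= \int[P]_v (logw w)^\+ v by exact: integral_ge0.
  have : 0 <= \int[P]_v (logw w)^\- v by exact: integral_ge0.
  case: (\int[P]_v (logw w)^\- v) => [n| |]//; last by rewrite addeNy leeNy_eq.
  case: (\int[P]_v (logw w)^\+ v) => [p| |]//; last by move=> *; rewrite addye// leey.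
  rewrite -EFinB !lee_fin => _ _; rewrite {1}LE.
  by lra.
have : \int[P]_w (\int[P]_v (logw w)^\- v + (Num.max L 0)%:E) <=
    \int[P]_w (\int[P]_v (logw w)^\+ v + (Num.max (- L) 0)%:E).
  apply: ge0_le_integral => //.
  - by move=> w _; apply: adde_ge0; [exact: integral_ge0|rewrite lee_fin].
  - by apply: emeasurable_funD => //; exact: measurable_cst.
  - by apply: emeasurable_funD => //; exact: measurable_cst.
rewrite (ge0_integral_add_cst P _ mneg Lp0); last by move=> w; exact: integral_ge0.
rewrite (ge0_integral_add_cst P _ mpos Ln0); last by move=> w; exact: integral_ge0.
rewrite -posE -negE /expect_log [X in _ -> _ <= X]integralE.
move: pos.
have : 0 <= \int[P]_w (fun w => lne (cabs (X w + Z w)%R)%:E)^\+ w.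
  exact: integral_ge0.
have : 0 <= \int[P]_w (fun w => lne (cabs (X w + Z w)%R)%:E)^\- w.
  exact: integral_ge0.
case: (\int[P]_w (fun w => lne (cabs (X w + Z w)%R)%:E)^\+ w) => [p| |]//.
case: (\int[P]_w (fun w => lne (cabs (X w + Z w)%R)%:E)^\- w) => [n| |]//.
by rewrite -EFinB !lee_fin => _ _ _ h; rewrite [leLHS]LE; lra.
Qed.

End LogOfSum.

Section FirstCoefficient.
Context {d : measure_display} {T : measurableType d} {R : realType}.
Variables (P : probability T R) (A : nat -> T -> R[i]) (n : nat).
Hypothesis A_RV : forall k, (k <= n)%N -> complex_RV (A k).
Hypothesis A_indep : first_independent P A n.
Local Notation C2 := (measurableTypeR R * measurableTypeR R)%type.

Let ev (k : nat) (V : set C2) : set T := (complex_pair \o A k) @^-1` V.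

Let measurable_ev k V : (k <= n)%N -> measurable V -> measurable (ev k V).
Proof. by move=> kn mV; rewrite -[ev k V]setTI; exact: A_RV. Qed.

(** A pi-system that generates the sigma-algebra of A_1, ..., A_n. *)
Let boxes : set (set T) := [set E | exists2 V : nat -> set C2,
  (forall k, measurable (V k)) &
  E = \bigcap_(k in [set k | (1 <= k <= n)%N]) ev k (V k)].

Let measurable_boxes : boxes `<=` measurable.
Proof.
move=> _ [V mV ->]; apply: bigcap_measurableType => k /andP[_ kn].
exact: measurable_ev.
Qed.

Let boxes_setI : setI_closed boxes.
Proof.
move=> _ _ [V mV ->] [W mW ->]; exists (fun k => V k `&` W k).
  by move=> k; exact: measurableI.
by rewrite -bigcapI.
Qed.

Let boxes_setT : boxes setT.
Proof.
by exists (fun=> setT) => //; apply/esym/seteqP; split.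
Qed.

(** Two finite measures that agree on the boxes agree on the sigma-algebra that the
    boxes generate. *)
Lemma first_independent_generated (U : set C2) (E : set T) : measurable U ->
  <<s boxes >> E -> (P (ev 0%N U `&` E) = P (ev 0%N U) * P E)%E.
Proof.
move=> mU; have mD : measurable (ev 0%N U) by exact: measurable_ev.
pose c : {nonneg R} := NngNum (fine_ge0 (measure_ge0 P (ev 0%N U))).
have cE : (c%:num)%:E = P (ev 0%N U) by rewrite fineK// fin_num_measure.
move=> sE; rewrite setIC.
suff key : mrestr P mD E = mscale c P E.
  by move: key; rewrite /mrestr /mscale cE.
apply: (@g_sigma_algebra_measure_unique _ R T boxes measurable_boxes
  (fun=> setT) (fun=> boxes_setT) _ (mrestr P mD) (mscale c P) boxes_setI) => //.
- by rewrite bigcup_const//; exists 0%N.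
- move=> _ [V mV ->]; set B := \bigcap_(k in _) _.
  rewrite [LHS](_ : _ = P (ev 0%N U `&` B)); last by rewrite setIC.
  rewrite [RHS](_ : _ = (P (ev 0%N U) * P B)%E); last by rewrite -cE.
  rewrite {}/B.
  pose V0 k := if k == 0%N then U else V k.
  have mV0 k : measurable (V0 k) by rewrite /V0; case: ifP.
  have := A_indep mV0; rewrite /V0 /=.
  have -> : \bigcap_(k in [set k | (1 <= k <= n)%N])
      (complex_pair \o A k) @^-1` (if k == 0%N then U else V k) =
      \bigcap_(k in [set k | (1 <= k <= n)%N]) ev k (V k).
    by apply: eq_bigcapr => k /andP[k0 _]; rewrite gt_eqF.
  by [].
- move=> k; rewrite [ltLHS](_ : _ = P (ev 0%N U)); last first.
    by rewrite -[in RHS](setTI (ev 0%N U)).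
  by apply: le_lt_trans (ltry 1); exact: probability_le1.
Qed.

Let T_late := g_sigma_algebraType boxes.

Let complex_RV_late k : (0 < k <= n)%N -> @complex_RV _ T_late R (A k).
Proof.
move=> kn _ V mV; rewrite setTI; apply: sub_sigma_algebra.
exists (fun j => if j == k then V else setT); first by move=> j; case: ifP.
apply/seteqP; split=> [w Vw j _|w /(_ k kn)]; last by rewrite /ev /= eqxx.
by rewrite /ev /=; case: eqP => // ->.
Qed.

(** A linear combination of the later coefficients is measurable with respect to the
    sigma-algebra that they generate. *)
Lemma first_independent_sum (c : nat -> R[i]) :
  let Z w := \sum_(k < n.+1 | (0 < k)%N) A k w * c k in
  forall U V : set C2, measurable U -> measurable V ->
  (P ((complex_pair \o A 0%N) @^-1` U `&` (complex_pair \o Z) @^-1` V) =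
   P ((complex_pair \o A 0%N) @^-1` U) * P ((complex_pair \o Z) @^-1` V))%E.
Proof.
move=> Z U V mU mV; apply: first_independent_generated => //.
have mZ : @complex_RV _ T_late R Z.
  apply: complex_RV_sum => k k0; apply: complex_RV_mul; last exact: complex_RV_cst.
  by apply: complex_RV_late; rewrite k0 -ltnS ltn_ord.
by have := mZ measurableT V mV; rewrite setTI.
Qed.

End FirstCoefficient.

(** The constant coefficient is b_00 (A_0 + Z) with Z independent of A_0, so the
    logarithm of D_n splits into three terms. *)
Lemma expect_log_end_coefs_ge {d : measure_display} {T : measurableType d}
    {R : realType} (P : probability T R) (b : nat -> nat -> R[i])
    (A : nat -> T -> R[i]) (n : nat) (t L : R) :
  (forall k, b k k != 0) -> 0 < t ->
  (forall k, (k <= n)%N -> complex_RV (A k)) ->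
  (forall k, (k <= n)%N -> ('E_P[fun w => (cabs (A k w) `^ t)%R] < +oo)%E) ->
  first_independent P A n ->
  (-oo < expect_log P (A n))%E ->
  (forall z : R[i], (L%:E <= expect_log P (fun w => (A 0%N w + z)%R))%E) ->
  ((ln (cabs (b 0%N 0%N * b n n)%R))%:E + expect_log P (A n) + L%:E <=
   expect_log P (end_coefs b A n))%E.
Proof.
move=> b0 t0 mA momA indA logA hL.
pose c k := b 0%N k / b 0%N 0%N.
pose Z w := \sum_(k < n.+1 | (0 < k)%N) A k w * c k.
have b00 := b0 0%N; have bnn := b0 n.
have DE w : end_coefs b A n w = b 0%N 0%N * b n n * (A n w * (A 0%N w + Z w)).
  have -> : A 0%N w + Z w = (b 0%N 0%N)^-1 * \sum_(k < n.+1) A k w * b 0%N k.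
    rewrite mulr_sumr (bigD1 ord0)//= mulrCA mulVf// mulr1; congr (_ + _).
    apply: eq_big => [k|k _]; first by rewrite -lt0n.
    by rewrite /c; ring.
  by rewrite /end_coefs; field.
have mZ : complex_RV Z.
  apply: complex_RV_sum => k _; apply: complex_RV_mul; last exact: complex_RV_cst.
  exact: (mA _ (ltn_ord k)).
have mA0 : complex_RV (A 0%N) by exact: mA.
have mS : complex_RV (fun w => A 0%N w + Z w) by exact: complex_RV_add.
have iA : P.-integrable setT (fun w => lne (cabs (A n w))%:E).
  apply: integrable_of_integral_gt => //.
    by apply: measurable_log_cabs; exact: mA.
  apply: (log_funepos_lt t0 mA momA (mA n (leqnn n)) ltr01) => w.
  rewrite mul1r /abs_sum big_ord_recr/= lerDr.
  by apply: sumr_ge0 => k _; exact: cabs_ge0.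
have pS : (\int[P]_w (fun w => lne (cabs (A 0%N w + Z w)%R)%:E)^\+ w < +oo)%E.
  pose K : R := 1 + \sum_(k < n.+1) cabs (c k).
  have K1 : 1 <= K by rewrite lerDl sumr_ge0// => k _; exact: cabs_ge0.
  have K0 : 0 < K by exact: lt_le_trans K1.
  apply: (log_funepos_lt t0 mA momA mS K0) => w.
  apply: le_trans (le_normcD _ _) _.
  rewrite /abs_sum (bigD1 ord0)//= mulrDr; apply: lerD.
    by rewrite -{1}[cabs _]mul1r ler_wpM2r// cabs_ge0.
  rewrite /Z -[X in cabs X]big_filter; apply: le_trans (cabs_sum_le _ _) _.
  rewrite big_filter mulr_sumr.
  rewrite (eq_bigl (fun k : 'I_n.+1 => k != ord0)); last first.
    by move=> k; rewrite -lt0n.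
  apply: ler_sum => k _; rewrite cabsM mulrC ler_wpM2r ?cabs_ge0//.
  rewrite /K (bigD1 k)//= addrCA lerDl addr_ge0// sumr_ge0// => j _.
  exact: cabs_ge0.
have LS : (L%:E <= expect_log P (fun w => A 0%N w + Z w)%R)%E.
  exact: (expect_log_add_ge mA0 mZ (first_independent_sum mA indA c) hL pS).
have iS : P.-integrable setT (fun w => lne (cabs (A 0%N w + Z w))%:E).
  apply: integrable_of_integral_gt => //; first exact: measurable_log_cabs.
  exact: lt_le_trans (ltNyr L) LS.
have -> : expect_log P (end_coefs b A n) =
    ((ln (cabs (b 0%N 0%N * b n n)%R))%:E + expect_log P (A n) +
     expect_log P (fun w => A 0%N w + Z w)%R)%E.
  rewrite /expect_log; under eq_integral do rewrite DE lne_cabsM (lne_cabsM (A n _)).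
  rewrite lne_EFin ?cabs_gt0 ?mulf_neq0//.
  rewrite integralD//; last 2 first.
  - exact: finite_measure_integrable_cst.
  - exact: integrableD.
  by rewrite integralD// integral_probability_cst addeA.
exact: leeD2l.
Qed.

Theorem theorem3p1 (R : realType) (b : nat -> nat -> R[i])
  (d : measure_display) (T : measurableType d) (P : probability T R)
  (A : nat -> nat -> T -> R[i]) (t r alpha beta : R)
  (b_neq0 : forall k, b k k != 0)
  (norm_limsup :
    (limn_esup (fun k => (sup_norm (basis_poly b k) `^ k%:R^-1)%:E) <= 1)%E)
  (lead_lim : (fun k => cabs (b k k) `^ k%:R^-1) @ \oo --> (1 : R))
  (t_gt0 : 0 < t)
  (A_RV : forall n k, (k <= n)%N -> complex_RV (A n k))
  (A_moment : forall n k, (k <= n)%N ->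
    ('E_P[fun w => (cabs (A n k w) `^ t)%R] < +oo)%E)
  (r_gt0 : 0 < r) (r_lt1 : r < 1)
  (alpha_ge0 : 0 <= alpha) (alpha_lt_beta : alpha < beta)
  (beta_lt2pi : beta < pi *+ 2) :
  [/\ t <= 1 -> \forall n \near \oo,
        (-oo < expect_log P (end_coefs b (A n) n))%E ->
        (expected_discrepancy P b (A n) n r alpha beta <=
           discrepancy_bound P b (A n) n t r)%E,
      forall (n : nat) (L : R),
        first_independent P (A n) n ->
        (-oo < expect_log P (A n n))%E ->
        (forall z : R[i],
          (L%:E <= expect_log P (fun w => (A n 0 w + z)%R))%E) ->
        ((ln (cabs (b 0 0 * b n n)%R))%:E + expect_log P (A n n) + L%:E <=
           expect_log P (end_coefs b (A n) n))%E /\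
        (-oo < (ln (cabs (b 0 0 * b n n)%R))%:E +
               expect_log P (A n n) + L%:E)%E &
      t <= 1 -> \forall n \near \oo, forall L : R,
        first_independent P (A n) n ->
        (-oo < expect_log P (A n n))%E ->
        (forall z : R[i],
          (L%:E <= expect_log P (fun w => (A n 0 w + z)%R))%E) ->
        (expected_discrepancy P b (A n) n r alpha beta <=
           discrepancy_bound P b (A n) n t r)%E].
Proof.
have r01 : 0 < r < 1 by rewrite r_gt0.
have part1 n : t <= 1 -> (0 < n)%N ->
    (-oo < expect_log P (end_coefs b (A n) n))%E ->
    (expected_discrepancy P b (A n) n r alpha beta <=
       discrepancy_bound P b (A n) n t r)%E.
  by move=> t1 n0 hlog; apply: expected_discrepancy_le => // k kn;
    [exact: A_RV|exact: A_moment].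
have part2 (n : nat) (L : R) : first_independent P (A n) n ->
    (-oo < expect_log P (A n n))%E ->
    (forall z : R[i], (L%:E <= expect_log P (fun w => (A n 0 w + z)%R))%E) ->
    ((ln (cabs (b 0 0 * b n n)%R))%:E + expect_log P (A n n) + L%:E <=
       expect_log P (end_coefs b (A n) n))%E /\
    (-oo < (ln (cabs (b 0 0 * b n n)%R))%:E + expect_log P (A n n) + L%:E)%E.
  move=> ind logA hL; split; last first.
    by case: (expect_log P (A n n)) logA => [s| |]// _; exact: ltNyr.
  by apply: (expect_log_end_coefs_ge (t := t)) => // k kn;
    [exact: A_RV|exact: A_moment].
split=> // t1; exists 1%N => // n /= n0.
  exact: part1.
move=> L ind logA hL; apply: part1 => //.
by have [le lt] := part2 n L ind logA hL; exact: lt_le_trans lt le.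
Qed.
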